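(* Let $\Omega\subset\mathbb R^3$ be a bounded Lipschitz domain, $0<T<\infty$, $\mathcal T_h$ a tetrahedral mesh of $\Omega$ from a shape-regular family, $k\ge0$, and let $\mathcal N_h^0,\mathcal{RT}_h,\mathcal Q_h$ be the compatible Nédélec, Raviart–Thomas and piecewise polynomial spaces defined in the context (so that $\operatorname{curl}\mathcal N_h^0\subset\mathcal{RT}_h$ and $\operatorname{div}:\mathcal{RT}_h\to\mathcal Q_h$ is onto). Let $E_h\in H^1(0,T;\mathcal N_h^0)$ and $B_h\in H^1(0,T;\mathcal{RT}_h)$ satisfy, for a.e. $t\in(0,T)$, $$(\partial_tB_h(t),\phi_h)+(\operatorname{curl}E_h(t),\phi_h)=0\qquad\forall\phi_h\in\mathcal{RT}_h.$$ Then, for every $q_h\in\mathcal Q_h$, $$(\operatorname{div}B_h(t),q_h)=(\operatorname{div}B_h(0),q_h)\qquad\text{for a.e. }t\in[0,T).$$ In particular, if $(\operatorname{div}B_h(0),q_h)=0$ for all $q_h\in\mathcal Q_h$, then $(\operatorname{div}B_h(t),q_h)=0$ for all $q_h\in\mathcal Q_h$ and a.e. $t$.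
   Context: $(\cdot,\cdot)$ is the $L^2$ scalar product on $\Omega$. $H(\operatorname{curl};\Omega)$ and $H(\operatorname{div};\Omega)$ are the spaces of $L^2(\Omega)^3$ fields with curl, respectively divergence, in $L^2$; $H_0(\operatorname{curl};\Omega)$ is the subspace of $H(\operatorname{curl};\Omega)$ with vanishing tangential trace. Spaces: $\mathcal N_h^0=\{v_h\in H_0(\operatorname{curl};\Omega):v_h|_K\in\mathcal N_k(K)\ \forall K\in\mathcal T_h\}$, $\mathcal{RT}_h=\{w_h\in H(\operatorname{div};\Omega):w_h|_K\in\mathcal{RT}_k(K)\ \forall K\in\mathcal T_h\}$, $\mathcal Q_h=\{q_h\in L^2(\Omega):q_h|_K\in\mathbb P_k(K)\ \forall K\in\mathcal T_h\}$, where $\mathcal N_k(K)=\mathbb P_k(K)^3+x\times\widetilde{\mathbb P}_k(K)^3$ (Nédélec, first kind), $\mathcal{RT}_k(K)=\mathbb P_k(K)^3+x\,\widetilde{\mathbb P}_k(K)$ (Raviart–Thomas), and $\mathbb P_k$ ($\widetilde{\mathbb P}_k$) denotes polynomials of degree $\le k$ (homogeneous of degree $k$). *)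

(* Defs.v *)
(* MathComp-Analysis, over an arbitrary R : realType. *)
From HB Require Import structures.
From mathcomp Require Import all_boot all_order all_algebra.
From mathcomp Require Import all_classical all_reals all_analysis.
(* The notations of mpoly clash with those of mathcomp-analysis. *)
From mathcomp Require Import -(notations) mpoly.

Set Implicit Arguments.
Unset Strict Implicit.
Unset Printing Implicit Defensive.

Import Order.TTheory GRing.Theory Num.Theory.
Import numFieldNormedType.Exports.

Local Open Scope classical_set_scope.
Local Open Scope ring_scope.

(* Points and vectors of R^3 are row vectors; coordinates are indexed by 'I_3,
   whose addition is modulo 3.  The library norm on 'rV[R]_3 is the sup norm,
   hence the separate Euclidean norm below. *)
Definition sfield (R : realType) := 'rV[R]_3 -> R.
Definition vfield (R : realType) := 'rV[R]_3 -> 'rV[R]_3.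

Definition dot (R : realType) (u v : 'rV[R]_3) : R :=
  \sum_(i < 3) u 0 i * v 0 i.

Definition enorm (R : realType) (u : 'rV[R]_3) : R := Num.sqrt (dot u u).

Definition cross (R : realType) (u v : 'rV[R]_3) : 'rV[R]_3 :=
  \row_(i < 3) (u 0 (i + 1) * v 0 (i + 2) - u 0 (i + 2) * v 0 (i + 1)).

(** Lebesgue measure on R^3 *)

(* 'rV[R]_3 carries no measurable structure, so integrals over subsets of R^3
   are taken on R * R * R with the product measure, through [pt3]. *)
Definition leb (R : realType) : {measure set (measurableTypeR R) -> \bar R} :=
  @lebesgue_measure R.

Definition R3 (R : realType) : Type :=
  (measurableTypeR R * measurableTypeR R * measurableTypeR R)%type.

Definition vol (R : realType) :
    {measure set (measurableTypeR R * measurableTypeR R * measurableTypeR R)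
       -> \bar R} :=
  ((@lebesgue_measure R \x @lebesgue_measure R) \x @lebesgue_measure R)%E.

Definition pt3 (R : realType) (p : R3 R) : 'rV[R]_3 :=
  \row_(i < 3) nth 0 [:: p.1.1 : R; p.1.2 : R; p.2 : R] i.

Definition ae_on (R : realType) (A : set 'rV[R]_3) (P : 'rV[R]_3 -> Prop) :=
  {ae vol R, forall p, A (pt3 p) -> P (pt3 p)}.

Definition intg (R : realType) (A : set 'rV[R]_3) (f : sfield R) : R :=
  \int[vol R]_(p in @pt3 R @^-1` A) f (pt3 p).

Definition sL2 (R : realType) (A : set 'rV[R]_3) (f : sfield R) : Prop :=
  measurable_fun (@pt3 R @^-1` A) (f \o @pt3 R) /\
  (vol R).-integrable (@pt3 R @^-1` A) (fun p => (f (pt3 p) ^+ 2)%:E).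

Definition vL2 (R : realType) (A : set 'rV[R]_3) (v : vfield R) : Prop :=
  forall i, sL2 A (fun x => v x 0 i).

Definition sinner (R : realType) (A : set 'rV[R]_3) (f g : sfield R) : R :=
  intg A (fun x => f x * g x).

Definition vinner (R : realType) (A : set 'rV[R]_3) (u v : vfield R) : R :=
  intg A (fun x => dot (u x) (v x)).

Definition L2norm (R : realType) (A : set 'rV[R]_3) (v : vfield R) : R :=
  Num.sqrt (vinner A v v).

(** Classical derivatives and test functions *)

Definition partial (R : realType) (i : 'I_3) (f : sfield R) : sfield R :=
  'D_(delta_mx 0 i) f.

Definition smooth (R : realType) (f : sfield R) : Prop :=
  forall s : seq 'I_3,
    continuous (foldr (@partial R) f s) /\
    forall x i, derivable (foldr (@partial R) f s) x (delta_mx 0 i).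

Definition stest (R : realType) (A : set 'rV[R]_3) (f : sfield R) : Prop :=
  smooth f /\
  exists C, [/\ compact C, C `<=` A & forall x, ~ C x -> f x = 0].

Definition vtest (R : realType) (A : set 'rV[R]_3) (v : vfield R) : Prop :=
  forall i, stest A (fun x => v x 0 i).

Definition grad (R : realType) (f : sfield R) : vfield R :=
  fun x => \row_(i < 3) partial i f x.

Definition ccurl (R : realType) (v : vfield R) : vfield R :=
  fun x => \row_(i < 3) (partial (i + 1) (fun y => v y 0 (i + 2)) x
                       - partial (i + 2) (fun y => v y 0 (i + 1)) x).

(** Weak derivatives, H(curl), H(div), H^1 and the tangential trace *)

Definition is_weak_partial (R : realType) (A : set 'rV[R]_3) (i : 'I_3)
    (f g : sfield R) : Prop :=
  sL2 A g /\
  forall phi, stest A phi -> sinner A f (partial i phi) = - sinner A g phi.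

Definition is_weak_curl (R : realType) (A : set 'rV[R]_3)
    (v w : vfield R) : Prop :=
  vL2 A w /\
  forall phi, vtest A phi -> vinner A v (ccurl phi) = vinner A w phi.

Definition is_weak_div (R : realType) (A : set 'rV[R]_3)
    (v : vfield R) (g : sfield R) : Prop :=
  sL2 A g /\
  forall phi, stest A phi -> vinner A v (grad phi) = - sinner A g phi.

(* Weak derivatives are unique up to a null set; [curl] and [div] select a
   representative, and are meaningful on Hcurl and Hdiv respectively. *)
Definition curl (R : realType) (A : set 'rV[R]_3) (v : vfield R) : vfield R :=
  get [set w | is_weak_curl A v w].

Definition div (R : realType) (A : set 'rV[R]_3) (v : vfield R) : sfield R :=
  get [set g | is_weak_div A v g].

Definition Hcurl (R : realType) (A : set 'rV[R]_3) : set (vfield R) :=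
  [set v | vL2 A v /\ exists w, is_weak_curl A v w].

Definition Hdiv (R : realType) (A : set 'rV[R]_3) : set (vfield R) :=
  [set v | vL2 A v /\ exists g, is_weak_div A v g].

Definition vH1 (R : realType) (A : set 'rV[R]_3) : set (vfield R) :=
  [set v | vL2 A v /\
     forall i j, exists g, is_weak_partial A i (fun x => v x 0 j) g].

(* The tangential trace n x v of v in H(curl; A), an element of the dual of
   the trace space H^{1/2}, is defined by Green's formula
   <n x v, phi> = (curl v, phi) - (v, curl phi) for phi in H^1(A)^3. *)
Definition tangential_trace (R : realType) (A : set 'rV[R]_3)
    (v phi : vfield R) : R :=
  vinner A (curl A v) phi - vinner A v (curl A phi).

Definition H0curl (R : realType) (A : set 'rV[R]_3) : set (vfield R) :=
  [set v | Hcurl A v /\ forall phi, vH1 A phi -> tangential_trace A v phi = 0].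

(** Domains *)

(* Near each boundary point, after an orthogonal change of coordinates, the
   domain is the part of space strictly above a Lipschitz graph. *)
Definition lipschitz_boundary (R : realType) (A : set 'rV[R]_3) : Prop :=
  forall x, (closure A `\` interior A) x ->
  exists (Q : 'M[R]_3) (g : R * R -> R) (r : R),
    [/\ Q *m Q^T = 1%:M, lipschitz g, 0 < r &
        forall y, enorm (y - x) < r ->
          let z := y *m Q in A y <-> g (z 0 0, z 0 1) < z 0 2].

Definition bounded_lipschitz_domain (R : realType) (A : set 'rV[R]_3) : Prop :=
  [/\ A !=set0, open A, connected A, bounded_set A & lipschitz_boundary A].

(** Tetrahedral meshes; the rows of K are the four vertices *)

Definition hull (R : realType) (K : 'M[R]_(4, 3)) (J : {set 'I_4}) :
    set 'rV[R]_3 :=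
  [set x | exists l : 'rV[R]_4,
     [/\ forall i, 0 <= l 0 i, forall i, i \notin J -> l 0 i = 0,
         \sum_(i < 4) l 0 i = 1 & x = l *m K]].

Definition tetra (R : realType) (K : 'M[R]_(4, 3)) : set 'rV[R]_3 :=
  hull K [set: 'I_4]%SET.

Definition nondegenerate (R : realType) (K : 'M[R]_(4, 3)) : Prop :=
  \det (\matrix_(i < 3, j < 3) (K (lift ord0 i) j - K ord0 j)) != 0.

Definition common_vertices (R : realType) (K K' : 'M[R]_(4, 3)) : {set 'I_4} :=
  [set i | [exists j, row i K == row j K']]%SET.

Definition tetrahedral_mesh (R : realType) (A : set 'rV[R]_3)
    (Th : seq 'M[R]_(4, 3)) : Prop :=
  [/\ forall K, K \in Th -> nondegenerate K,
      closure A = \bigcup_(K in [set` Th]) tetra K,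
      forall K K', K \in Th -> K' \in Th -> K != K' ->
        interior (tetra K) `&` interior (tetra K') = set0 &
      forall K K', K \in Th -> K' \in Th ->
        tetra K `&` tetra K' = hull K (common_vertices K K')].

Definition diameter (R : realType) (K : set 'rV[R]_3) : R :=
  sup [set enorm (p.1 - p.2) | p in K `*` K].

Definition inball_diameter (R : realType) (K : set 'rV[R]_3) : R :=
  sup [set 2 * r | r in [set r : R | 0 <= r /\
         exists c, forall y, enorm (y - c) <= r -> K y]].

Definition shape_regular (R : realType) (H : Type)
    (Th : H -> seq 'M[R]_(4, 3)) : Prop :=
  exists sigma : R, forall h K, K \in Th h ->
    diameter (tetra K) <= sigma * inball_diameter (tetra K).

(** Local polynomial spaces and finite element spaces *)

Definition poly_fun (R : realType) (k : nat) : set (sfield R) :=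
  [set f : sfield R | exists P : mpoly 3 R,
     (msize P <= k.+1)%N /\ forall x : 'rV[R]_3, f x = meval (x 0) P].

Definition hpoly_fun (R : realType) (k : nat) : set (sfield R) :=
  [set f : sfield R | exists P : mpoly 3 R,
     P \is ishomog1 k mdeg /\ forall x : 'rV[R]_3, f x = meval (x 0) P].

Definition nedelec (R : realType) (k : nat) : set (vfield R) :=
  [set v | exists p q : vfield R,
     [/\ forall i, poly_fun k (fun x => p x 0 i),
         forall i, hpoly_fun k (fun x => q x 0 i) &
         forall x, v x = p x + cross x (q x)]].

Definition raviart_thomas (R : realType) (k : nat) : set (vfield R) :=
  [set v | exists (p : vfield R) (q : sfield R),
     [/\ forall i, poly_fun k (fun x => p x 0 i), hpoly_fun k q &
         forall x, v x = p x + q x *: x]].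

(* Membership of the restriction of v to K is meant up to a null set, in
   particular regardless of the values on the faces of K. *)
Definition piecewise (R : realType) (U : Type) (S : set ('rV[R]_3 -> U))
    (Th : seq 'M[R]_(4, 3)) : set ('rV[R]_3 -> U) :=
  [set v | forall K, K \in Th ->
     exists2 p, S p & ae_on (interior (tetra K)) (fun x => v x = p x)].

Definition N0h (R : realType) (A : set 'rV[R]_3) (Th : seq 'M[R]_(4, 3))
    (k : nat) : set (vfield R) :=
  H0curl A `&` piecewise (@nedelec R k) Th.

Definition RTh (R : realType) (A : set 'rV[R]_3) (Th : seq 'M[R]_(4, 3))
    (k : nat) : set (vfield R) :=
  Hdiv A `&` piecewise (@raviart_thomas R k) Th.

Definition Qh (R : realType) (A : set 'rV[R]_3) (Th : seq 'M[R]_(4, 3))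
    (k : nat) : set (sfield R) :=
  [set q | sL2 A q] `&` piecewise (@poly_fun R k) Th.

(** Bochner spaces L^2(0,T;V) and H^1(0,T;V) *)

(* V is a subspace of L^2(A)^3, with the L^2 norm (for finite-dimensional V
   the choice of the norm is immaterial). *)
Record simple_fun (R : realType) := SimpleFun {
  sf_size : nat;
  sf_set : 'I_sf_size -> set (measurableTypeR R);
  sf_val : 'I_sf_size -> vfield R }.

Definition sf_valid (R : realType) (V : set (vfield R)) (T : R)
    (s : simple_fun R) : Prop :=
  forall i : 'I_(sf_size s),
    [/\ measurable (sf_set i), sf_set i `<=` `]0, T[ & V (sf_val i)].

Definition sf_eval (R : realType) (s : simple_fun R) (t : R) : vfield R :=
  \sum_(i < sf_size s) (\1_(sf_set i) t : R) *: sf_val i.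

Definition sf_integral (R : realType) (s : simple_fun R) : vfield R :=
  \sum_(i < sf_size s) fine (leb R (sf_set i)) *: sf_val i.

Definition sf_approx (R : realType) (A : set 'rV[R]_3) (V : set (vfield R))
    (T : R) (s : nat -> simple_fun R) (f : R -> vfield R) : Prop :=
  (forall n, sf_valid V T (s n)) /\
  {ae leb R, forall t : R, t \in `]0, T[ ->
     L2norm A (f t - sf_eval (s n) t) @[n --> \oo] --> (0 : R)}.

Definition strongly_measurable (R : realType) (A : set 'rV[R]_3)
    (V : set (vfield R)) (T : R) (f : R -> vfield R) : Prop :=
  exists s, sf_approx A V T s f.

Definition is_bochner_integral (R : realType) (A : set 'rV[R]_3)
    (V : set (vfield R)) (T : R) (f : R -> vfield R) (I : vfield R) : Prop :=
  V I /\
  exists s : nat -> simple_fun R,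
    [/\ sf_approx A V T s f,
        (\int[leb R]_(t in `]0%R, T[) (L2norm A (f t - sf_eval (s n) t))%:E)%E
          @[n --> \oo] --> 0%E &
        L2norm A (I - sf_integral (s n)) @[n --> \oo] --> (0 : R)].

Definition bochner_L2 (R : realType) (A : set 'rV[R]_3)
    (V : set (vfield R)) (T : R) : set (R -> vfield R) :=
  [set f | [/\ {ae leb R, forall t : R, t \in `]0, T[ -> V (f t)},
     strongly_measurable A V T f &
     (\int[leb R]_(t in `]0%R, T[) (L2norm A (f t) ^+ 2)%:E < +oo)%E]].

Definition time_test (R : realType) (T : R) (psi : R -> R) : Prop :=
  (forall n t, derivable (derive1n n psi) t 1) /\
  exists C, [/\ compact C, C `<=` `]0, T[ & forall t, ~ C t -> psi t = 0].

Definition is_time_deriv (R : realType) (A : set 'rV[R]_3)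
    (V : set (vfield R)) (T : R) (f df : R -> vfield R) : Prop :=
  bochner_L2 A V T df /\
  forall psi, time_test T psi ->
    exists2 I, is_bochner_integral A V T (fun t => derive1 psi t *: f t) I &
               is_bochner_integral A V T (fun t => - (psi t *: df t)) I.

Definition bochner_H1 (R : realType) (A : set 'rV[R]_3)
    (V : set (vfield R)) (T : R) : set (R -> vfield R) :=
  [set f | bochner_L2 A V T f /\ exists df, is_time_deriv A V T f df].

(* A representative of the weak time derivative, unique up to null sets. *)
Definition time_deriv (R : realType) (A : set 'rV[R]_3)
    (V : set (vfield R)) (T : R) (f : R -> vfield R) : R -> vfield R :=
  get [set df | is_time_deriv A V T f df].

(* fc is the representative of f in C([0,T];V), which gives meaning to the
   pointwise values of f, such as f(0) = fc 0, for f in H^1(0,T;V). *)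
Definition continuous_representative (R : realType) (A : set 'rV[R]_3)
    (V : set (vfield R)) (T : R) (f fc : R -> vfield R) : Prop :=
  [/\ forall t, t \in `[0, T] -> V (fc t),
      forall t, t \in `[0, T] ->
        L2norm A (fc s - fc t) @[s --> within `[0, T] (nbhs t)] --> (0 : R) &
      {ae leb R, forall t : R, t \in `]0, T[ ->
         ae_on A (fun x => f t x = fc t x)}].

(* Main.v *)
Require Import Defs.
From HB Require Import structures.
From mathcomp Require Import all_boot all_order all_algebra.
From mathcomp Require Import all_classical all_reals all_analysis.
From mathcomp Require Import measurable_realfun ring lra.
From mathcomp Require Import -(notations) mpoly.
Set Implicit Arguments.
Unset Strict Implicit.
Unset Printing Implicit Defensive.
Import Order.TTheory GRing.Theory Num.Theory.
Import numFieldNormedType.Exports.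
Local Open Scope classical_set_scope.
Local Open Scope ring_scope.

(** Why the theorem is true.

    The curl of a Nedelec field is piecewise polynomial of degree [k] and is
    orthogonal to every gradient of a test function, so it is a Raviart-Thomas
    field of weak divergence zero ([curl_N0h]).  The sum of the time derivative
    of [Bh] and of [curl Eh] is then itself an admissible test field in the
    discrete Faraday law, which forces its norm to vanish; hence the time
    derivative of [Bh] is orthogonal to every gradient [grad phi] as well
    ([orthogonal_residual]).  Consequently the scalar function
    [t |-> (Bhc t, grad phi)], which is continuous, has vanishing weak
    derivative and is constant on [[0, T]] ([pairing_constant]).  Since weak
    divergences are determined by the pairings with gradients, [Bh t] and
    [Bhc 0] have the same weak divergences for almost every [t]
    ([weak_div_eq]), and one null set serves all [phi] and all [q] at once,
    because the constancy in time holds for every [t].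

    Two steps carry the analysis.  The first is that the weak curl of a field
    that agrees with a polynomial on a cell is the classical curl there
    ([weak_curl_polynomial]): integration by parts against tensor products of
    one-dimensional bumps ([polynomial_parts]) reduces to monomials, where the
    integrals factor, and the fundamental lemma of the calculus of variations
    ([fundamental_lemma]) is obtained by letting the bumps tend to indicators
    of boxes and extending from boxes to all measurable sets with Dynkin's
    theorem.  Here the Lipschitz boundary is used: it makes the interior of
    every cell lie inside the domain ([interior_closure_lipschitz]).  That the
    curl of a gradient vanishes rests on the symmetry of second derivatives
    ([partialC]).

    The second is the passage from vector-valued to scalar integrals:
    pairing a Bochner integral with a fixed field gives the integral of the
    pairing ([bochner_pairing]), by the Cauchy-Schwarz inequality, and a
    continuous function of time with vanishing weak derivative is constant
    ([weak_derive0_le]). *)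

(** * Smooth functions of one real variable *)

Section Smooth1.
Context {R : realType}.
Implicit Types (f g : R -> R) (n : nat).

(** Recursion on the derivative, rather than a bound on iterated derivatives,
    makes the closure properties below plain inductions. *)
Fixpoint ndiff n f : Prop :=
  (forall t, derivable f t 1) /\ if n is m.+1 then ndiff m (derive1 f) else True.

Definition smooth1 f := forall n, ndiff n f.

Lemma ndiff_derivable n f t : ndiff n f -> derivable f t 1.
Proof. by case: n => [|n] [df _]; exact: df. Qed.

Lemma ndiffW n f : ndiff n.+1 f -> ndiff n f.
Proof.
elim: n f => [|n IH] f [df dff]; first by split.
by split=> //; exact: IH.
Qed.

Lemma derivableDfun f g t :
  derivable f t 1 -> derivable g t 1 -> derivable (f \+ g) t 1.
Proof. by move=> df dg; exact: (@derivableD _ _ _ f g). Qed.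

Lemma ndiffD n f g : ndiff n f -> ndiff n g -> ndiff n (f \+ g).
Proof.
elim: n f g => [|n IH] f g [df Hf] [dg Hg]; split.
- by move=> t; exact: derivableDfun.
- by [].
- by move=> t; exact: derivableDfun.
suff -> : derive1 (f \+ g) = derive1 f \+ derive1 g by exact: IH.
apply/funext => t; rewrite /= !derive1E.
by rewrite (@deriveD _ _ _ f g t 1 (df t) (dg t)).
Qed.

Lemma ndiffZ n (c : R) f : ndiff n f -> ndiff n (fun x => c * f x).
Proof.
elim: n f => [|n IH] f [df Hf]; split.
- by move=> t; apply: (@derivableZ _ _ _ f c).
- by [].
- by move=> t; apply: (@derivableZ _ _ _ f c).
suff -> : derive1 (fun x => c * f x) = (fun x => c * derive1 f x) by exact: IH.
by apply/funext => t; rewrite !derive1E (@deriveZ _ _ _ f c t 1 (df t)).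
Qed.

Lemma ndiffM n f g : ndiff n f -> ndiff n g -> ndiff n (fun x => f x * g x).
Proof.
elim: n f g => [|n IH] f g df dg.
  by split=> // t; apply: derivableM; [apply: (ndiff_derivable df)|apply: (ndiff_derivable dg)].
split.
  by move=> t; apply: derivableM; [apply: (ndiff_derivable df)|apply: (ndiff_derivable dg)].
have -> : derive1 (fun x => f x * g x) =
    (fun x => f x * derive1 g x) \+ (fun x => g x * derive1 f x).
  apply/funext => t; rewrite !derive1E.
  by rewrite (@deriveM _ _ f g t 1 (ndiff_derivable df) (ndiff_derivable dg)) /= !derive1E.
by case: (df) (dg) => [_ df'] [_ dg']; apply: ndiffD; apply: IH => //; exact: ndiffW.
Qed.

Lemma ndiff_cst n (c : R) : ndiff n (fun=> c).
Proof.
elim: n c => [|n IH] c; split=> //.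
rewrite (_ : derive1 _ = cst 0); first exact: IH.
by apply/funext => t; rewrite derive1_cst.
Qed.

Lemma ndiff_comp_affine n (c d : R) f :
  ndiff n f -> ndiff n (fun x => f (c * x + d)).
Proof.
have dl (t : R) : is_derive t 1 (fun x : R => c * x + d) c.
  have := is_deriveD (is_deriveZ c (is_derive_id t (1 : R))) (is_derive_cst d t 1).
  by rewrite addr0 /GRing.scale /= mulr1.
elim: n f => [|n IH] f [df Hf].
  split=> // t; apply/derivable1_diffP.
  by apply: differentiable_comp; apply/derivable1_diffP; [case: (dl t)|exact: df].
split.
  move=> t; apply/derivable1_diffP.
  by apply: differentiable_comp; apply/derivable1_diffP; [case: (dl t)|exact: df].
rewrite (_ : derive1 _ = (fun x => c * (derive1 f) (c * x + d))).
  by apply: ndiffZ; exact: IH.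
apply/funext => t.
rewrite (@derive1_comp _ (fun x : R => c * x + d) f t); last 2 first.
- by case: (dl t).
- exact: df.
rewrite mulrC; congr (_ * _).
by rewrite derive1E; case: (dl t).
Qed.

Lemma smooth1_derive f : smooth1 f -> smooth1 (derive1 f).
Proof. by move=> sf n; case: (sf n.+1). Qed.

Lemma smooth1_derivable f t : smooth1 f -> derivable f t 1.
Proof. by move=> /(_ 0%N) [+ _]; exact. Qed.

Lemma smooth1_continuous f : smooth1 f -> continuous f.
Proof.
move=> sf t; apply: differentiable_continuous.
by apply/derivable1_diffP; exact: smooth1_derivable.
Qed.

Lemma smooth1_derive1n f n : smooth1 f -> smooth1 (derive1n n f).
Proof. by move=> sf; elim: n => //= n IH; exact: smooth1_derive. Qed.

Lemma smooth1M f g : smooth1 f -> smooth1 g -> smooth1 (fun x => f x * g x).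
Proof. by move=> sf sg n; exact: ndiffM. Qed.

Lemma smooth1D f g : smooth1 f -> smooth1 g -> smooth1 (f \+ g).
Proof. by move=> sf sg n; exact: ndiffD. Qed.

Lemma smooth1Z c f : smooth1 f -> smooth1 (fun x => c * f x).
Proof. by move=> sf n; exact: ndiffZ. Qed.

End Smooth1.
(** * A smooth step function *)

Section Flat.
Context {R : realType}.

(** For [m = 0] this is the usual flat function [exp (- 1 / x)]; the powers are
    carried along because the derivative of one member of the family is a
    combination of two others. *)
Definition flat (m : nat) (x : R) : R :=
  if 0 < x then x ^- m * expR (- x^-1) else 0.

Lemma flat_ge0 m x : 0 <= flat m x.
Proof.
rewrite /flat; case: ifPn => // x0.
by rewrite mulr_ge0 ?expR_ge0// invr_ge0 exprn_ge0// ltW.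
Qed.

Lemma expn_expRN_le (m : nat) (y : R) :
  0 < y -> y ^+ m.+1 * expR (- y) <= (m.+1)`!%:R.
Proof.
move=> y0; rewrite expRN ler_pdivrMr ?expR_gt0// mulrC -ler_pdivrMr ?ltr0n ?fact_gt0//.
by apply: le_trans (expR_ge1Dxn m (ltW y0)); rewrite lerDr.
Qed.

(** At [y = 1 / x] this is the bound on [y ^ (m + 2) exp (- y)]; a quadratic
    bound is what kills the difference quotients at the origin. *)
Lemma flat_le_sqr m : exists2 C : R, 0 <= C & forall x, flat m x <= C * x ^+ 2.
Proof.
exists (m.+2)`!%:R => // x; rewrite /flat; case: ifPn => [x0|_]; last first.
  by rewrite mulr_ge0// sqr_ge0.
rewrite -ler_pdivrMr ?exprn_gt0//.
have xV0 : 0 < x^-1 by rewrite invr_gt0.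
apply: le_trans (expn_expRN_le m.+1 xV0).
by rewrite -(addn2 m) exprD !exprVn mulrAC.
Qed.

Lemma is_derive0_le_sqr (f : R -> R) (C : R) :
  0 <= C -> (forall y, `|f y| <= C * y ^+ 2) -> is_derive (0 : R) (1 : R) f 0.
Proof.
move=> C0 fC.
have f0 : f 0 = 0.
  by apply/eqP; rewrite -normr_le0; apply: le_trans (fC 0) _; rewrite expr0n mulr0.
have cv : h^-1 *: ((f \o shift 0) (h *: (1 : R)) - f 0) @[h --> (0 : R)^'] --> (0 : R).
  apply/cvgr0Pnorm_le => e e0; near=> h.
  have h0 : h != 0 by near: h; exact: nbhs_dnbhs_neq.
  rewrite /= f0 addr0 subr0 /GRing.scale/= mulr1 normrM normfV.
  rewrite mulrC ler_pdivrMr ?normr_gt0//.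
  apply: le_trans (fC h) _; apply: (@le_trans _ _ ((C + 1) * h ^+ 2)).
    by rewrite ler_wpM2r ?sqr_ge0 ?lerDl.
  rewrite -(real_normK (num_real h)) expr2 mulrA.
  rewrite ler_wpM2r//.
  rewrite -ler_pdivlMl; last by rewrite ltr_pwDr.
  rewrite mulrC; near: h; apply: dnbhs0_le.
  by apply: divr_gt0 => //; rewrite ltr_pwDr.
apply: DeriveDef; first by apply/cvg_ex; exists 0.
exact/cvg_lim.
Unshelve. all: by end_near. Qed.

Lemma is_derive_flat m x :
  is_derive (x : R) (1 : R) (flat m) (- m%:R * flat m.+1 x + flat m.+2 x).
Proof.
have [x0|x0|->] := ltgtP x 0.
- rewrite /flat !ltNge (ltW x0)/= mulr0 addr0.
  apply: (near_eq_is_derive _ (is_derive_cst 0 x 1)).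
  near=> y; have y0 : y < 0 by near: y; exact: lt_nbhsl.
  by rewrite ltNge (ltW y0).
- have xn0 : x != 0 by rewrite gt_eqF.
  rewrite {2 3}/flat x0.
  have D : is_derive x 1 (fun y : R => y ^- m * expR (- y^-1))
    (- m%:R * (x ^- m.+1 * expR (- x^-1)) + x ^- m.+2 * expR (- x^-1)).
    have DX := is_deriveX m (is_derive_id x (1 : R)).
    rewrite exprfctE in DX.
    have DV := @is_deriveV _ (fun y : R => y ^+ m) x _ 1 (expf_neq0 m xn0) DX.
    have Di := @is_deriveV _ id x _ 1 xn0 (is_derive_id x (1 : R)).
    have DN : is_derive x (1 : R) (fun y : R => - y^-1) (- (- x ^- 2 *: (1 : R))).
      exact: is_deriveN Di.
    have DE := @is_derive1_comp _ expR (fun y : R => - y^-1) x _ _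
      (is_derive_expR (- x^-1)) DN.
    have := is_deriveM DV DE.
    move/is_derive_eq; apply.
    rewrite /GRing.scale /= !mulr1; move: (expR _) => E.
    case: m {DX DV DE} => [|m].
      by rewrite expr0; field.
    by rewrite /= !exprS; field; rewrite xn0 expf_neq0.
  apply: (near_eq_is_derive _ D).
  near=> y; have y0 : 0 < y by near: y; exact: lt_nbhsr.
  by rewrite /flat y0.
have [C C0 HC] := flat_le_sqr m.
rewrite {2 3}/flat ltxx mulr0 addr0.
apply: (is_derive0_le_sqr C0) => y.
by rewrite ger0_norm ?flat_ge0.
Unshelve. all: by end_near. Qed.

End Flat.
Section Step.
Context {R : realType}.

Lemma ndiff_flat n m : ndiff n (@flat R m).
Proof.
elim: n m => [|n IH] m.
  by split=> // t; case: (is_derive_flat m t).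
split; first by move=> t; case: (is_derive_flat m t).
rewrite (_ : derive1 _ = (fun x => - m%:R * flat m.+1 x) \+ flat m.+2).
  by apply: ndiffD => //; exact: ndiffZ.
by apply/funext => t; rewrite derive1E; case: (is_derive_flat m t).
Qed.

(** The dilation by [n + 1] steepens the bump at both ends, so that it tends to
    the indicator of the open interval as [n] grows. *)
Definition bump (n : nat) (a b : R) (x : R) : R :=
  flat 0 (n.+1%:R * x - n.+1%:R * a) * flat 0 (n.+1%:R * b - n.+1%:R * x).

Lemma smooth1_bump n a b : smooth1 (bump n a b).
Proof.
move=> k; apply: ndiffM.
  exact: (@ndiff_comp_affine _ k n.+1%:R (- (n.+1%:R * a)) _ (ndiff_flat k 0)).
under eq_fun do rewrite addrC -mulNr.
exact: (@ndiff_comp_affine _ k (- n.+1%:R) (n.+1%:R * b) _ (ndiff_flat k 0)).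
Qed.

Lemma flat0_gt0 (x : R) : (0 < flat 0 x) = (0 < x).
Proof.
rewrite /flat; case: ifPn => [x0|]; last by rewrite ltxx.
by rewrite mulr_gt0 ?expR_gt0// expr0 invr1.
Qed.

Lemma flat0_le1 (x : R) : flat 0 x <= 1.
Proof.
rewrite /flat; case: ifPn => [x0|_]; last exact: ler01.
by rewrite expr0 invr1 mul1r expR_le1 oppr_le0 invr_ge0 ltW.
Qed.

Lemma bump_ge0 n a b x : 0 <= bump n a b x.
Proof. by rewrite mulr_ge0 ?flat_ge0. Qed.

Lemma bump_le1 n a b x : bump n a b x <= 1.
Proof. by rewrite mulr_ile1 ?flat_ge0 ?flat0_le1. Qed.

Lemma bump_gt0 n a b x : (0 < bump n a b x) = (a < x < b).
Proof.
have n0 : 0 < n.+1%:R :> R by rewrite ltr0n.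
rewrite lt0r bump_ge0 andbT mulf_eq0 negb_or.
have H y : (@flat R 0 y != 0) = (0 < y) by rewrite -flat0_gt0 lt0r flat_ge0 andbT.
by rewrite !H -!mulrBr !pmulr_rgt0// !subr_gt0.
Qed.

Lemma bump_eq0 n a b x : ~~ (a < x < b) -> bump n a b x = 0.
Proof.
by rewrite -(bump_gt0 n) -leNgt => H; apply/eqP; rewrite eq_le H bump_ge0.
Qed.

Lemma flat0_cvg1 (x : R) : 0 < x -> flat 0 (n.+1%:R * x) @[n --> \oo] --> (1 : R).
Proof.
move=> x0.
have E n : flat 0 (n.+1%:R * x) = expR (- (n.+1%:R^-1 * x^-1)).
  by rewrite /flat pmulr_rgt0 ?ltr0n// x0 expr0 invr1 mul1r invfM.
have H : (- (n.+1%:R^-1 * x^-1) : R) @[n --> \oo] --> (0 : R).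
  rewrite -oppr0 -[X in - X](mul0r x^-1); apply: cvgN; apply: cvgMl.
  exact: cvg_harmonic.
rewrite (_ : (fun n => _) = (fun n : nat => expR (- (n.+1%:R^-1 * x^-1)))); last exact/funext.
by have := cvg_comp _ _ H (@continuous_expR R 0); rewrite expR0.
Qed.

Lemma bump_cvg (a b x : R) :
  bump n a b x @[n --> \oo] --> (\1_(`]a, b[%classic : set R) x : R).
Proof.
rewrite indicE; have [|xab] := boolP (x \in `]a, b[%classic); last first.
  rewrite /= (_ : (fun n => _) = cst 0); first exact: cvg_cst.
  apply/funext => n; rewrite bump_eq0//; apply: contra xab => xab.
  by rewrite inE/= in_itv.
rewrite inE /= in_itv/= => /andP[ax xb].
rewrite -[X in _ --> X]mulr1 /bump.
under eq_cvg do rewrite -!mulrBr.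
by apply: cvgM; apply: flat0_cvg1; rewrite subr_gt0.
Qed.

End Step.
(** * Boxes and measurability in space *)

Section Space.
Context {R : realType}.
Implicit Types (a b x : 'rV[R]_3) (U : set 'rV[R]_3).

Definition obox a b : set 'rV[R]_3 := [set x | forall i, a 0 i < x 0 i < b 0 i].
Definition cbox a b : set 'rV[R]_3 := [set x | forall i, a 0 i <= x 0 i <= b 0 i].

Lemma forall_ord3 (P : 'I_3 -> Prop) : (forall i, P i) <-> [/\ P 0, P 1 & P 2].
Proof.
split=> [H|[H0 H1 H2] i]; first by split.
by case: i => -[|[|[|//]]] p; [move: H0|move: H1|move: H2];
  congr P; apply: val_inj.
Qed.

Lemma pt3E (p : R3 R) : [/\ pt3 p 0 0 = p.1.1, pt3 p 0 1 = p.1.2 & pt3 p 0 2 = p.2].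
Proof. by split; rewrite mxE. Qed.

Lemma pt3_obox a b : @pt3 R @^-1` obox a b =
  (`]a 0 0, b 0 0[ `*` `]a 0 1, b 0 1[) `*` `]a 0 2, b 0 2[.
Proof.
apply/seteqP; split => p; rewrite /preimage/= /obox/= !in_itv/=.
  by move=> /forall_ord3; have [-> -> ->] := pt3E p; case.
by move=> [[? ?] ?]; apply/forall_ord3; have [-> -> ->] := pt3E p.
Qed.

Lemma measurable_obox a b : measurable (@pt3 R @^-1` obox a b : set (R3 R)).
Proof.
by rewrite pt3_obox; apply: measurableX; [apply: measurableX|]; exact: measurable_itv.
Qed.

Definition ratv (q : 'rV[rat]_3) : 'rV[R]_3 := map_mx (@ratr R) q.

(** Rational boxes are countably many, which turns topology into measurability
    for the product sigma-algebra.  The closed box stays inside the open set so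
    that bumps carried by it are test functions. *)
Lemma open_ratbox U x : open U -> U x ->
  exists q : 'rV[rat]_3 * 'rV[rat]_3,
    obox (ratv q.1) (ratv q.2) x /\ cbox (ratv q.1) (ratv q.2) `<=` U.
Proof.
move=> oU Ux.
have /nbhs_ballP[e /= e0 HU] : nbhs x U by exact: open_nbhs_nbhs.
have H1 i : exists q : rat, ratr q \in `](x 0 i - e), (x 0 i)[.
  by apply: rat_in_itvoo; rewrite ltrBlDr ltrDl.
have H2 i : exists q : rat, ratr q \in `](x 0 i), (x 0 i + e)[.
  by apply: rat_in_itvoo; rewrite ltrDl.
have [p Hp] := choice H1; have [q Hq] := choice H2.
exists (\row_i p i, \row_i q i); split=> [i|y Hy] /=.
  rewrite !mxE; move: (Hp i) (Hq i); rewrite !in_itv/=.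
  by move=> /andP[_ ->] /andP[->].
apply: HU; split=> [//|i j]; rewrite !ord1 /=.
have := Hy j; rewrite !mxE /= => /andP[yl yu].
move: (Hp j) (Hq j); rewrite !in_itv/= => /andP[pl _] /andP[_ qu].
rewrite /ball/= ltr_distlC; apply/andP; split.
  by apply: lt_le_trans pl yl.
by apply: le_lt_trans yu qu.
Qed.

Lemma open_bigcup_ratbox U : open U ->
  U = \bigcup_(q in [set q : 'rV[rat]_3 * 'rV[rat]_3 | cbox (ratv q.1) (ratv q.2) `<=` U])
        obox (ratv q.1) (ratv q.2).
Proof.
move=> oU; apply/seteqP; split => [x Ux|x [q /= qU qx]].
  by have [q [qx qU]] := open_ratbox oU Ux; exists q.
by apply: qU => i; have /andP[/ltW-> /ltW->] := qx i.
Qed.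

Lemma measurable_open U : open U -> measurable (@pt3 R @^-1` U : set (R3 R)).
Proof.
move=> oU; rewrite (open_bigcup_ratbox oU) preimage_bigcup.
rewrite bigcup_mkcond; apply: countable_bigcupT_measurable; first exact: countableP.
by move=> q; case: ifP => _; [exact: measurable_obox|exact: measurable0].
Qed.

Lemma measurable_continuous (f : sfield R) : continuous f ->
  measurable_fun setT (f \o @pt3 R : R3 R -> R).
Proof.
move=> cf; apply: (measurability _ (RGenOInfty.measurableE R)).
move=> _ [_ [x ->] <-]; rewrite setTI comp_preimage.
apply: measurable_open; move/continuousP: cf; apply.
exact: rray_open.
Qed.

End Space.
(** * Square-integrable fields as a semi-inner product space *)

Lemma integrable_eq d (T : measurableType d) (R : realType)
    (mu : {measure set T -> \bar R}) (D : set T) (f g : T -> \bar R) :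
  measurable D -> mu.-integrable D f -> (forall x, D x -> f x = g x) ->
  mu.-integrable D g.
Proof.
by move=> mD fi fg; apply: (eq_integrable mD f) => // x; rewrite inE; exact: fg.
Qed.

Section L2.
Context {R : realType} (A : set 'rV[R]_3).
Hypothesis mA : measurable (@pt3 R @^-1` A : set (R3 R)).
Implicit Types (f g h : sfield R) (u v w : vfield R).

Let integ f := (vol R).-integrable (@pt3 R @^-1` A) (fun p => (f (pt3 p))%:E).

(** Integrable because [|f g| <= f ^ 2 + g ^ 2]. *)
Lemma sL2_prod f g : sL2 A f -> sL2 A g -> integ (fun x => f x * g x).
Proof.
move=> [mf f2] [mg g2].
apply: (le_integrable mA _ _ (integrableD mA f2 g2)).
  by apply/measurable_EFinP; exact: measurable_funM.
move=> p _ /=; rewrite lee_fin ler_norml.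
rewrite [X in _ <= _ <= X]ger0_norm ?addr_ge0 ?sqr_ge0//.
rewrite [X in - X]ger0_norm ?addr_ge0 ?sqr_ge0//.
move: (f _) (g _) => s t; have ? := sqr_ge0 (s + t); have ? := sqr_ge0 (s - t).
by apply/andP; split; nra.
Qed.

Lemma sL2D f g : sL2 A f -> sL2 A g -> sL2 A (fun x => f x + g x).
Proof.
move=> sf sg; have [mf f2] := sf; have [mg g2] := sg.
split; first exact: measurable_funD.
have fg := integrableZl mA 2 (sL2_prod sf sg).
apply: (integrable_eq mA (integrableD mA (integrableD mA f2 g2) fg)) => p _ /=.
by rewrite -!EFinM -!EFinD; congr EFin; ring.
Qed.

Lemma sL2Z (c : R) f : sL2 A f -> sL2 A (fun x => c * f x).
Proof.
move=> [mf f2]; split; first exact: measurable_funM.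
apply: (integrable_eq mA (integrableZl mA (c ^+ 2) f2)) => p _ /=.
by rewrite -!EFinM exprMn.
Qed.

Lemma sL2_cst0 : sL2 A (fun=> 0).
Proof.
split; first exact: measurable_cst.
apply: (integrable_eq mA (integrable0 _ _)) => p _ /=.
by rewrite expr0n.
Qed.

Lemma sinnerDl f g h : sL2 A f -> sL2 A g -> sL2 A h ->
  sinner A (fun x => f x + g x) h = sinner A f h + sinner A g h.
Proof.
move=> sf sg sh; rewrite /sinner /intg -RintegralD//; [|exact: sL2_prod|exact: sL2_prod].
by apply: eq_Rintegral => p _; rewrite mulrDl.
Qed.

Lemma sinnerZl c f g : sL2 A f -> sL2 A g ->
  sinner A (fun x => c * f x) g = c * sinner A f g.
Proof.
move=> sf sg; rewrite /sinner /intg -RintegralZl//; [|exact: sL2_prod].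
by apply: eq_Rintegral => p _; rewrite mulrA.
Qed.

Lemma sinner0l f : sinner A (fun=> 0) f = 0.
Proof.
rewrite /sinner /intg; under eq_Rintegral do rewrite mul0r.
by rewrite Rintegral_cst// mul0r.
Qed.

Lemma vL2D u v : vL2 A u -> vL2 A v -> vL2 A (u + v).
Proof.
move=> su sv i; rewrite (_ : (fun x => _) = (fun x => u x 0 i + v x 0 i)).
  exact: sL2D.
by apply/funext => x; rewrite mxE.
Qed.

Lemma vL2Z c u : vL2 A u -> vL2 A (c *: u).
Proof.
move=> su i; rewrite (_ : (fun x => _) = (fun x => c * u x 0 i)).
  exact: sL2Z.
by apply/funext => x; rewrite mxE.
Qed.

Lemma vL2N u : vL2 A u -> vL2 A (- u).
Proof. by rewrite -scaleN1r; exact: vL2Z. Qed.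

Lemma vL2_0 : vL2 A 0.
Proof.
move=> i; rewrite (_ : (fun x => _) = (fun=> 0)); first exact: sL2_cst0.
by apply/funext => x; rewrite mxE.
Qed.

Lemma vL2_sum n (F : 'I_n -> vfield R) :
  (forall i, vL2 A (F i)) -> vL2 A (\sum_(i < n) F i).
Proof.
move=> H; elim/big_ind : _ => //; [exact: vL2_0|exact: vL2D].
Qed.

Lemma vinnerE u v : vL2 A u -> vL2 A v ->
  vinner A u v = \sum_(i < 3) sinner A (fun x => u x 0 i) (fun x => v x 0 i).
Proof.
move=> su sv.
have P i : (vol R).-integrable (@pt3 R @^-1` A)
  (EFin \o (fun p => u (pt3 p) 0 i * v (pt3 p) 0 i)) by exact: (sL2_prod (su i) (sv i)).
rewrite !big_ord_recr big_ord0/= add0r /sinner /intg -!RintegralD//.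
  by apply: eq_Rintegral => p _; rewrite /dot !big_ord_recr big_ord0/= add0r.
exact: (integrableD mA (P _) (P _)).
Qed.

Lemma vinnerC u v : vinner A u v = vinner A v u.
Proof. by apply: eq_Rintegral => p _; apply: eq_bigr => i _; rewrite mulrC. Qed.

Lemma vinnerDl u v w : vL2 A u -> vL2 A v -> vL2 A w ->
  vinner A (u + v) w = vinner A u w + vinner A v w.
Proof.
move=> su sv sw; rewrite !vinnerE//; last exact: vL2D.
rewrite -big_split/=; apply: eq_bigr => i _; rewrite -sinnerDl//.
by congr sinner; apply/funext => x; rewrite mxE.
Qed.

Lemma vinnerZl c u w : vL2 A u -> vL2 A w -> vinner A (c *: u) w = c * vinner A u w.
Proof.
move=> su sw; rewrite !vinnerE//; last exact: vL2Z.
rewrite mulr_sumr; apply: eq_bigr => i _; rewrite -sinnerZl//.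
by congr sinner; apply/funext => x; rewrite mxE.
Qed.

Lemma vinnerBl u v w : vL2 A u -> vL2 A v -> vL2 A w ->
  vinner A (u - v) w = vinner A u w - vinner A v w.
Proof.
move=> su sv sw; rewrite vinnerDl//; last exact: vL2N.
by rewrite -scaleN1r vinnerZl// mulN1r.
Qed.

Lemma vinner0l w : vinner A 0 w = 0.
Proof.
rewrite /vinner /intg (_ : (fun p => _) = cst 0) ?Rintegral_cst ?mul0r//.
by apply/funext => p; rewrite /dot big1// => i _; rewrite mxE mul0r.
Qed.

Lemma vinner_suml n (F : 'I_n -> vfield R) w :
  (forall i, vL2 A (F i)) -> vL2 A w ->
  vinner A (\sum_(i < n) F i) w = \sum_(i < n) vinner A (F i) w.
Proof.
move=> HF sw.
suff [] : vL2 A (\sum_(i < n) F i) /\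
  vinner A (\sum_(i < n) F i) w = \sum_(i < n) vinner A (F i) w by [].
elim/big_rec2 : _ => [|i y1 y2 _ [s IH]].
  by split; [exact: vL2_0|exact: vinner0l].
by split; [exact: vL2D|rewrite vinnerDl// IH].
Qed.

Lemma vinner_ge0 u : 0 <= vinner A u u.
Proof.
apply: Rintegral_ge0 => p _; apply: sumr_ge0 => i _.
by rewrite -expr2 sqr_ge0.
Qed.

(** The discriminant argument for [c |-> |u + c v| ^ 2].  When [v] has norm zero
    this polynomial is affine and nonnegative, so its slope [2 (u, v)]
    vanishes. *)
Lemma cauchy_schwarz u v : vL2 A u -> vL2 A v ->
  `|vinner A u v| <= L2norm A u * L2norm A v.
Proof.
move=> su sv.
rewrite -sqrtr_sqr /L2norm -sqrtrM ?vinner_ge0// ler_wsqrtr//.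
have suv c : vL2 A (u + c *: v) by apply: vL2D => //; exact: vL2Z.
have Q c : 0 <= vinner A u u + 2 * c * vinner A u v + c ^+ 2 * vinner A v v.
  have := vinner_ge0 (u + c *: v).
  rewrite vinnerDl//; last exact: vL2Z.
  rewrite vinnerZl// ![vinner _ _ (u + _)]vinnerC !vinnerDl//; try exact: vL2Z.
  rewrite !vinnerZl// [vinner A v u]vinnerC.
  by rewrite expr2; move/le_trans; apply; rewrite le_eqVlt; apply/orP; left; apply/eqP; ring.
have := vinner_ge0 v; rewrite le_eqVlt => /orP[/eqP v0|vp].
  rewrite -v0 mulr0 in Q *.
  move: Q; set b := vinner A u v; set a := vinner A u u => Q.
  have [->|b0] := eqVneq b 0; first by rewrite expr0n.
  (* the parameter at which the affine function takes the value -1 *)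
  have := Q (- (a + 1) / (2 * b)).
  have -> : a + 2 * (- (a + 1) / (2 * b)) * b + (- (a + 1) / (2 * b)) ^+ 2 * 0 = -1 by field.
  by rewrite ler0N1.
have := Q (- vinner A u v / vinner A v v).
move: vp; set b := vinner A u v; set a := vinner A u u; set c := vinner A v v => vp.
have -> : a + 2 * (- b / c) * b + (- b / c) ^+ 2 * c = (a * c - b ^+ 2) / c.
  by field; rewrite gt_eqF.
by rewrite pmulr_lge0 ?invr_gt0// subr_ge0.
Qed.

End L2.
(** * Pairing a Bochner integral with a fixed field *)

Section Ae.
Context d (T : measurableType d) (R : realType) (mu : {measure set T -> \bar R}).

Lemma aeS (P Q : T -> Prop) : (forall t, P t -> Q t) ->
  {ae mu, forall t, P t} -> {ae mu, forall t, Q t}.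
Proof. by move=> PQ; apply: filterS. Qed.

Lemma aeI (P Q : T -> Prop) :
  {ae mu, forall t, P t} -> {ae mu, forall t, Q t} -> {ae mu, forall t, P t /\ Q t}.
Proof. by move=> HP HQ; apply: filterS2 HP HQ. Qed.

End Ae.

Section NonMeasurable.
Local Open Scope ereal_scope.
Context d (T : measurableType d) (R : realType) (mu : {measure set T -> \bar R}).

(** The integral of a nonnegative function is a supremum over simple functions
    below it, so the larger function need not be measurable. *)
Lemma ae_le_integral_upper (D : set T) (f g : T -> \bar R) :
  measurable D -> measurable_fun D f ->
  (forall x, D x -> 0 <= f x) -> (forall x, D x -> 0 <= g x) ->
  {ae mu, forall x, D x -> f x <= g x} ->
  \int[mu]_(x in D) f x <= \int[mu]_(x in D) g x.
Proof.
move=> mD mf f0 g0 [N [mN N0 HN]].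
pose f' := f \_ (~` N).
have mf' : measurable_fun D f'.
  apply/(measurable_restrict _ (measurableC mN) mD).
  by apply: measurable_funS mf => //; exact: subIsetl.
have f'0 x : D x -> 0 <= f' x.
  by move=> Dx; rewrite /f' patchE; case: ifP => // _; exact: f0.
have -> : \int[mu]_(x in D) f x = \int[mu]_(x in D) f' x.
  apply: ge0_ae_eq_integral => //; exists N; split => // x /= H.
  apply: contrapT => Nx; apply: H => Dx.
  by rewrite /f' patchE mem_set.
rewrite !ge0_integralE//; apply: le_ereal_sup => _ [h /= hf <-].
exists h => // x; apply: le_trans (hf x) _.
rewrite !patchE; case: ifPn => // /set_mem Dx.
rewrite /f' patchE; case: ifPn => [/set_mem Nx|_]; last exact: g0.
by apply: contrapT => H; apply: Nx; apply: HN => /= /(_ Dx).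
Qed.

End NonMeasurable.

Section Bochner.
Context {R : realType} (A : set 'rV[R]_3).
Hypothesis mA : measurable (@pt3 R @^-1` A : set (R3 R)).
Variables (V : set (vfield R)) (T : R) (w : vfield R).
Hypotheses (VL2 : V `<=` vL2 A) (wL2 : vL2 A w).

Lemma vL2_sf_eval s t : sf_valid V T s -> vL2 A (sf_eval s t).
Proof.
move=> sV; apply: (vL2_sum mA) => i; apply: (vL2Z mA); apply: VL2.
by case: (sV i).
Qed.

Lemma vL2_sf_integral s : sf_valid V T s -> vL2 A (sf_integral s).
Proof.
move=> sV; apply: (vL2_sum mA) => i; apply: (vL2Z mA); apply: VL2.
by case: (sV i).
Qed.

Lemma sf_pairing_eval s t : sf_valid V T s -> vinner A (sf_eval s t) w =
  \sum_(i < sf_size s) \1_(sf_set i) t * vinner A (sf_val i) w.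
Proof.
move=> sV; have sfL i : vL2 A (@sf_val R s i) by apply: VL2; case: (sV i).
rewrite (vinner_suml mA)//; last by move=> i; exact: vL2Z.
by apply: eq_bigr => i _; rewrite (vinnerZl mA).
Qed.

Let D : set (measurableTypeR R) := `]0, T[.
Let mD : measurable D. Proof. exact: measurable_itv. Qed.

Lemma integrable_indic_mul (E : set (measurableTypeR R)) (c : R) :
  measurable E -> E `<=` D ->
  (leb R).-integrable D (fun t => (\1_E t * c)%:E).
Proof.
move=> mE ED; apply: (@measurable_bounded_integrable _ _ _ (leb R)) => //.
- change (lebesgue_measure [set` `]0%R, T[] < +oo)%E.
  by rewrite lebesgue_measure_itv/=; case: ifP => _; rewrite -?EFinB ltry.
- exact: measurable_funM.
exists `|c|; split; rewrite ?num_real// => M cM t _ /=.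
apply: le_trans (ltW cM); rewrite normrM ler_piMl// indicE.
by case: (t \in E); rewrite ?normr1 ?normr0.
Qed.

Lemma Rintegral_indic_mul (E : set (measurableTypeR R)) (c : R) :
  measurable E -> E `<=` D ->
  \int[leb R]_(t in D) (\1_E t * c) = fine (leb R E) * c.
Proof.
move=> mE ED.
under eq_Rintegral do rewrite mulrC.
rewrite RintegralZl//; last first.
  by apply: (integrable_eq mD (integrable_indic_mul 1 mE ED)) => t _; rewrite mulr1.
by rewrite mulrC /Rintegral integral_indic// setIidl.
Qed.

Lemma sf_pairing_integral s : sf_valid V T s ->
  (leb R).-integrable D (fun t => (vinner A (sf_eval s t) w)%:E) /\
  \int[leb R]_(t in D) vinner A (sf_eval s t) w = vinner A (sf_integral s) w.
Proof.
move=> sV; have sfL i : vL2 A (@sf_val R s i) by apply: VL2; case: (sV i).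
rewrite (vinner_suml mA)//; last by move=> i; exact: vL2Z.
have -> : (fun t => vinner A (sf_eval s t) w) =
    (fun t => \sum_(i < sf_size s) \1_(sf_set i) t * vinner A (sf_val i) w).
  by apply/funext => t; rewrite sf_pairing_eval.
have -> : (fun t => (vinner A (sf_eval s t) w)%:E) =
    (fun t => (\sum_(i < sf_size s) \1_(sf_set i) t * vinner A (sf_val i) w)%:E).
  by apply/funext => t; rewrite sf_pairing_eval.
under eq_bigr do rewrite (vinnerZl mA)//.
elim: (index_enum _) => [|i r [IHi IHe]].
  split; first by under eq_fun do rewrite big_nil; exact: integrable0.
  rewrite big_nil; under eq_Rintegral do rewrite big_nil.
  by rewrite Rintegral_cst// mul0r.
have [mE ED _] := sV i; have iE := integrable_indic_mul (vinner A (sf_val i) w) mE ED.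
split.
  by under eq_fun do rewrite big_cons EFinD; exact: integrableD.
under eq_Rintegral do rewrite big_cons.
by rewrite RintegralD// IHe big_cons Rintegral_indic_mul.
Qed.

(** The norms [|f t - s t|] need not be measurable in [t], so measurability is
    asked of the scalar function [g] only, and the comparison with the integrals
    of the norms is the one-sided [ae_le_integral_upper]. *)
Lemma bochner_pairing (f : R -> vfield R) (I : vfield R) (g : R -> R) :
  is_bochner_integral A V T f I ->
  {ae leb R, forall t : R, t \in `]0, T[ -> vL2 A (f t) /\ g t = vinner A (f t) w} ->
  (leb R).-integrable D (fun t => (g t)%:E) ->
  vinner A I w = \int[leb R]_(t in D) g t.
Proof.
move=> [VI [s [[sV _] s0 I0]]] fg ig.
(* adding 1 keeps the constant invertible when [w] has norm zero *)
have W0 : 0 < L2norm A w + 1 by rewrite ltr_pwDr// sqrtr_ge0.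
have wW : L2norm A w <= L2norm A w + 1 by rewrite lerDl.
set W := L2norm A w + 1 in W0 wW.
have key n : (`|\int[leb R]_(t in D) g t - vinner A (sf_integral (s n)) w|%:E <=
    W%:E * \int[leb R]_(t in D) (L2norm A (f t - sf_eval (s n) t))%:E)%E.
  have [isg <-] := sf_pairing_integral (sV n).
  rewrite -RintegralB//.
  set d := fun t => g t - vinner A (sf_eval (s n) t) w.
  have idt : (leb R).-integrable D (EFin \o d) by exact: (integrableB mD ig isg).
  apply: (@le_trans _ _ (\int[leb R]_(t in D) `|(d t)%:E|)%E).
    rewrite /Rintegral -abse_EFin fineK.
      exact: le_abse_integral (measurable_int _ idt).
    exact: integrable_fin_num.
  rewrite -lee_pdivrMl//.
  rewrite -ge0_integralZl//; last 2 first.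
    by apply: measurableT_comp => //; exact: measurable_int idt.
    by rewrite lee_fin invr_ge0 ltW.
  apply: ae_le_integral_upper => //.
  - apply: emeasurable_funM => //.
    by apply: measurableT_comp => //; exact: measurable_int idt.
  - by move=> t _; rewrite mule_ge0// lee_fin invr_ge0 ltW.
  - by move=> t _; rewrite lee_fin sqrtr_ge0.
  apply: aeS fg => t H Dt; have [ft gt] := H Dt.
  rewrite abse_EFin -EFinM lee_fin ler_pdivrMl// mulrC /d gt.
  have st := vL2_sf_eval t (sV n).
  rewrite -(vinnerBl mA)//; apply: le_trans (cauchy_schwarz mA _ _) _ => //.
    by apply: (vL2D mA) => //; exact: vL2N.
  by rewrite ler_wpM2l// sqrtr_ge0.
apply/eqP; rewrite -subr_eq0 -normr_le0; apply/ler_addgt0Pr => e e0; rewrite add0r.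
have e2 : 0 < e / 2 / W by rewrite !divr_gt0.
pose r n := (\int[leb R]_(t in D) (L2norm A (f t - sf_eval (s n) t))%:E)%E.
have [fr r0] : (\forall n \near \oo, r n \is a fin_num) /\
    fine (r n) @[n --> \oo] --> (0 : R).
  exact/fine_cvgP.
have {}r0 := (cvgr0Pnorm_lt _).1 r0 _ e2.
have {}I0 := (cvgr0Pnorm_lt _).1 I0 _ e2.
have {}r0 := r0 eventually_filter; have {}I0 := I0 eventually_filter.
near \oo => n.
have fn : r n \is a fin_num by near: n.
have r1 : `|fine (r n)| < e / 2 / W by near: n; exact: r0.
have := key n; rewrite -/(r n) -(fineK fn) -EFinM lee_fin => H1.
have H2 : `|vinner A I w - vinner A (sf_integral (s n)) w| <= L2norm A (I - sf_integral (s n)) * W.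
  have sI := vL2_sf_integral (sV n); have LI := VL2 VI.
  rewrite -(vinnerBl mA)//; apply: le_trans (cauchy_schwarz mA _ _) _ => //.
    by apply: (vL2D mA) => //; exact: vL2N.
  by rewrite ler_wpM2l// sqrtr_ge0.
have i1 : `|L2norm A (I - sf_integral (s n))| < e / 2 / W.
  by near: n; exact: I0.
rewrite -(subrKA (vinner A (sf_integral (s n)) w)) [X in _ <= X](splitr e).
apply: le_trans (ler_normD _ _) _; apply: lerD.
  apply: le_trans H2 _; rewrite -ler_pdivlMr//.
  by apply: ltW; apply: le_lt_trans i1; exact: ler_norm.
rewrite distrC; apply: le_trans H1 _; rewrite mulrC -ler_pdivlMr//.
by apply: ltW; apply: le_lt_trans r1; exact: ler_norm.
Unshelve. all: by end_near. Qed.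

End Bochner.
(** * Functions of time with vanishing weak derivative *)

Section Time.
Context {R : realType}.
Implicit Types (f u : R -> R) (a b : R).
Notation mu := (@lebesgue_measure R).

Lemma Rintegral_support d (T : measurableType d) (nu : {measure set T -> \bar R})
    (D : set T) (f : T -> R) :
  (forall x, ~ D x -> f x = 0) -> \int[nu]_(x in D) f x = \int[nu]_x f x.
Proof.
move=> f0; rewrite Rintegral_mkcond; apply: eq_Rintegral => x _.
by rewrite patchE; case: ifPn => // /negP; rewrite inE => /f0 ->.
Qed.

Lemma integrable_support d (T : measurableType d) (nu : {measure set T -> \bar R})
    (D : set T) (f : T -> R) : measurable D ->
  (forall x, ~ D x -> f x = 0) ->
  nu.-integrable D (EFin \o f) -> nu.-integrable setT (EFin \o f).
Proof.
move=> mD f0 fi; apply: (integrable_eq measurableT ((integrable_mkcond _ mD).1 fi)).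
move=> x _; rewrite patchE; case: ifPn => // /negP; rewrite inE => Dx.
by rewrite /= f0.
Qed.

Lemma integrable_cc a b f : continuous f -> mu.-integrable `[a, b] (EFin \o f).
Proof.
move=> cf; apply: continuous_compact_integrable; first exact: segment_compact.
exact: continuous_subspaceT.
Qed.

Lemma integrableT_cc a b f : continuous f ->
  (forall x, ~ (a <= x <= b) -> f x = 0) -> mu.-integrable setT (EFin \o f).
Proof.
move=> cf f0; apply: (@integrable_support _ _ mu [set` `[a, b]] f) => //.
exact: integrable_cc.
Qed.

Lemma bump_support n a b x : ~ (a <= x <= b) -> bump n a b x = 0.
Proof.
move=> H; apply: bump_eq0; apply/negP => /andP[ax xb]; apply: H.
by rewrite !ltW.
Qed.

Lemma bump_integrable n a b : mu.-integrable setT (EFin \o bump n a b).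
Proof.
apply: (integrableT_cc (a := a) (b := b)); last exact: bump_support.
exact/smooth1_continuous/smooth1_bump.
Qed.

Lemma bump_integral_gt0 n a b : a < b -> 0 < \int[mu]_x bump n a b x.
Proof.
move=> ab; have bi := bump_integrable n a b.
rewrite lt_neqAle Rintegral_ge0 ?andbT; last by move=> x _; exact: bump_ge0.
apply/eqP => /esym H.
have : (\int[mu]_x `|(bump n a b x)%:E| = 0)%E.
  under eq_integral do rewrite abse_EFin ger0_norm ?bump_ge0//.
  by move: H; rewrite /Rintegral => H; rewrite -[LHS]fineK ?H//; exact: integrable_fin_num.
move/(ae_eq_integral_abs mu measurableT (measurable_int _ bi)).1 => [N [mN N0 HN]].
have : (mu `]a, b[ <= mu N)%E.
  apply: le_measure; rewrite ?inE//.
  move=> x /=; rewrite in_itv/= -(bump_gt0 n) => bx; apply: HN => /= /(_ I) [E].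
  by rewrite E ltxx in bx.
by rewrite N0 lebesgue_measure_itv/= lte_fin ab -EFinB lee_fin leNgt subr_gt0 ab.
Qed.

(** The primitive of a smooth function with compact support and mean zero is
    again a test function. *)
Lemma mean0_primitive (T a b : R) (chi : R -> R) :
  0 < a -> b < T -> smooth1 chi ->
  (forall x, ~ (a <= x <= b) -> chi x = 0) -> \int[mu]_x chi x = 0 ->
  exists2 psi, time_test T psi & derive1 psi = chi.
Proof.
move=> a0 bT schi chi0 Ichi.
have cchi := smooth1_continuous schi.
pose psi (x : R) := \int[mu]_(t in `]-oo, x]) chi t.
have ichi := integrableT_cc cchi chi0.
have D x : derivable psi x 1 /\ derive1 psi x = chi x.
  apply: (@continuous_FTC1 _ chi -oo%O x (x + 1)).
  - by rewrite ltrDl.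
  - by apply: integrableS ichi => //; exact: measurable_itv.
  - by rewrite /Order.lt/=.
  - exact: cchi.
have dpsi : derive1 psi = chi by apply/funext => x; case: (D x).
exists psi => //; split=> [[|n] t|]; first by case: (D t).
  rewrite /derive1n iterSr dpsi.
  by apply: smooth1_derivable; exact: smooth1_derive1n.
exists [set` `[a, b]]; split; first exact: segment_compact.
  by move=> x /=; rewrite !in_itv/= => /andP[ax xb]; rewrite (lt_le_trans a0)// (le_lt_trans xb).
move=> t /=; rewrite in_itv/= => tab.
have [ta|at_] := ltP t a.
  rewrite /psi -[RHS](mul0r (fine (mu `]-oo, t])%E)) -Rintegral_cst//.
  apply: eq_Rintegral => x; rewrite inE/= in_itv/= => xt; apply: chi0.
  by move=> /andP[ax _]; move: (lt_le_trans ta ax); rewrite ltNge xt.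
rewrite /psi Rintegral_support// => x; rewrite /= in_itv/= => xt; apply: chi0.
move=> /andP[ax xb]; apply: xt; apply: (le_trans xb).
by move: tab; rewrite at_/= => /negP; rewrite -ltNge => /ltW.
Qed.

(** Endpoints of the time interval are included: the interval found lies to the
    side of [s] where there is room. *)
Lemma subinterval_near (T s d : R) : 0 < T -> 0 < d -> 0 <= s <= T ->
  exists a b, [/\ 0 < a, a < b, b < T & forall y, a <= y <= b -> `|s - y| < d].
Proof.
move=> T0 d0 /andP[s0 sT].
pose e := Order.min d T / 8.
have m0 : 0 < Order.min d T by rewrite lt_min d0.
have e0 : 0 < e by rewrite divr_gt0.
have ed : 8 * e <= d by rewrite /e mulrC divfK// ge_min lexx.
have eT : 8 * e <= T by rewrite /e mulrC divfK// ge_min lexx orbT.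
have [sT2|sT2] := leP s (T / 2).
  exists (s + e), (s + 2 * e); split; [lra|lra|lra|].
  by move=> y /andP[? ?]; rewrite ltr_norml; lra.
exists (s - 2 * e), (s - e); split; [lra|lra|lra|].
by move=> y /andP[? ?]; rewrite ltr_norml; lra.
Qed.

(** Were [u] smaller than [m] on one interval and larger than [m'] on another,
    for [m < m'], the primitive of a suitable difference of bumps on the two
    intervals would contradict the hypothesis. *)
Lemma weak_derive0_le (T : R) u : 0 < T ->
  {within `[0, T], continuous u} ->
  (forall psi, time_test T psi -> \int[mu]_(t in `]0, T[) (derive1 psi t * u t) = 0) ->
  forall s t, s \in `[0, T] -> t \in `[0, T] -> u t <= u s.
Proof.
have contra (m m' C1 C2 J1 J2 : R) : m < m' -> 0 < C1 -> 0 < C2 ->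
    J1 <= m * C1 -> m' * C2 <= J2 -> C2 * J1 - C1 * J2 <> 0.
  move=> mm' C1p C2p L1 L2; have : 0 < (m' - m) * (C1 * C2).
    by apply: mulr_gt0; [rewrite subr_gt0|exact: mulr_gt0].
  have := ler_wpM2l (ltW C2p) L1; have := ler_wpM2l (ltW C1p) L2; lra.
move=> T0 cu Hu s t sT tT; rewrite leNgt; apply/negP => st.
pose m := (2 * u s + u t) / 3; pose m' := (u s + 2 * u t) / 3.
have [sm mm' mt] : [/\ u s < m, m < m' & m' < u t] by rewrite /m /m'; split; lra.
have near_lt r : r \in `[0, T] -> forall e : R, 0 < e -> exists a b,
    [/\ 0 < a, a < b, b < T & forall y, a <= y <= b -> `|u r - u y| < e].
  move=> rT e e0.
  have cur : u y @[y --> within `[0, T] (nbhs r)] --> u r.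
    by move/subspace_continuousP : cu; apply.
  have near_r : \forall y \near within `[0, T] (nbhs r), `|u r - u y| < e.
    by move/cvgr_dist_lt : cur; exact.
  have /nbhs_ballP[d /= d0 Hd] := near_r.
  have rT' : 0 <= r <= T by move: rT; rewrite in_itv.
  have [a [b [a0 ab bT H]]] := subinterval_near T0 d0 rT'.
  exists a, b; split=> // y yab; apply: Hd; first exact: H.
  move: yab => /andP[ay yb]; rewrite /= in_itv/= (le_trans (ltW a0) ay)/=.
  by rewrite (le_trans yb)// ltW.
have [a [b [a0 ab bT Hb]]] := near_lt s sT (m - u s) ltac:(by rewrite subr_gt0).
have [c [d [c0 cd dT Hd]]] := near_lt t tT (u t - m') ltac:(by rewrite subr_gt0).
pose b1 := bump 0 a b; pose b2 := bump 0 c d.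
have := bump_integral_gt0 0 ab; have := bump_integral_gt0 0 cd.
have i1 := bump_integrable 0 a b; have i2 := bump_integrable 0 c d.
rewrite -/b1 -/b2 in i1 i2 *.
set C1 := \int[mu]_x b1 x; set C2 := \int[mu]_x b2 x => C2p C1p.
have cb1 : continuous b1 by apply/smooth1_continuous/smooth1_bump.
have cb2 : continuous b2 by apply/smooth1_continuous/smooth1_bump.
(* the weights [C2] and [- C1] make the difference of bumps have mean zero *)
have [|||||psi tpsi dpsi] := @mean0_primitive T (Order.min a c) (Order.max b d)
  (fun x => C2 * b1 x + (- C1) * b2 x).
- by rewrite lt_min a0.
- by rewrite gt_max bT.
- by apply: smooth1D; apply: smooth1Z; exact: smooth1_bump.
- move=> x H; rewrite /b1 /b2 !bump_support ?mulr0 ?addr0// => /andP[h1 h2]; apply: H.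
    by rewrite ge_min h1 orbT le_max h2 orbT.
  by rewrite ge_min h1 le_max h2.
- rewrite RintegralD//; first by rewrite !RintegralZl// -/C1 -/C2; ring.
    by apply: (integrable_eq measurableT (integrableZl measurableT C2 i1)).
  by apply: (integrable_eq measurableT (integrableZl measurableT (- C1) i2)).
have mD : measurable (`]0, T[%classic : set (measurableTypeR R)) by exact: measurable_itv.
have ibu f : continuous f -> mu.-integrable `]0, T[ (EFin \o (fun t => f t * u t)).
  move=> cf.
  have I : mu.-integrable [set` `[0, T]] (EFin \o (fun t => f t * u t)).
    apply: continuous_compact_integrable; first exact: segment_compact.
    by move=> x; apply: cvgM; [exact: continuous_subspaceT|exact: cu].
  apply: integrableS I => //; exact: subset_itv_oo_cc.
have := Hu psi tpsi; rewrite dpsi.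
have -> : \int[mu]_(t0 in `]0, T[) ((C2 * b1 t0 + - C1 * b2 t0) * u t0) =
   C2 * \int[mu]_(x in `]0, T[) (b1 x * u x) - C1 * \int[mu]_(x in `]0, T[) (b2 x * u x).
  transitivity (\int[mu]_(x in `]0, T[) (C2 * (b1 x * u x)) -
                \int[mu]_(x in `]0, T[) (C1 * (b2 x * u x))); last first.
    by congr (_ - _); apply: RintegralZl => //; exact: ibu.
  rewrite -RintegralB//.
  + by apply: eq_Rintegral => x _; ring.
  + by apply: (integrable_eq mD (integrableZl mD C2 (ibu _ cb1))).
  + by apply: (integrable_eq mD (integrableZl mD C1 (ibu _ cb2))).
have E a' b' : 0 < a' -> b' < T -> \int[mu]_(x in `]0, T[) bump 0 a' b' x = \int[mu]_x bump 0 a' b' x.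
  move=> a'0 b'T; apply: Rintegral_support => x /=; rewrite in_itv/= => H.
  apply: bump_support => /andP[h1 h2]; apply: H.
  by rewrite (lt_le_trans a'0 h1) (le_lt_trans h2 b'T).
have iD f : mu.-integrable setT (EFin \o f) -> mu.-integrable `]0, T[ (EFin \o f).
  by move=> fi; apply: integrableS fi => //.
have L1 : \int[mu]_(x in `]0, T[) (b1 x * u x) <= m * C1.
  rewrite /C1 /b1 -(E _ _ a0 bT) -RintegralZl//; last exact: iD.
  apply: le_Rintegral => //; first exact: ibu.
    by apply: (integrable_eq mD (integrableZl mD m (iD _ i1))).
  move=> x _; rewrite mulrC; have [xab|xab] := boolP (a < x < b).
    rewrite ler_wpM2r ?bump_ge0//; have := Hb x; move: xab => /andP[/ltW-> /ltW->] /(_ isT).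
    by rewrite ltr_norml; lra.
  by rewrite bump_eq0// !mulr0.
have L2 : m' * C2 <= \int[mu]_(x in `]0, T[) (b2 x * u x).
  rewrite /C2 /b2 -(E _ _ c0 dT) -RintegralZl//; last exact: iD.
  apply: le_Rintegral => //; last 2 first.
  - exact: ibu.
  - move=> x _; rewrite [leRHS]mulrC; have [xab|xab] := boolP (c < x < d).
      rewrite ler_wpM2r ?bump_ge0//; have := Hd x; move: xab => /andP[/ltW-> /ltW->] /(_ isT).
      by rewrite ltr_norml; lra.
    by rewrite bump_eq0// !mulr0.
  by apply: (integrable_eq mD (integrableZl mD m' (iD _ i2))).
exact: contra mm' C1p C2p L1 L2.
Qed.
End Time.
(** * Test functions in space: partial derivatives, symmetry, gradients *)

Section Partial.
Context {R : realType}.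
Implicit Types (f g : sfield R) (x y : 'rV[R]_3) (i j : 'I_3).

Definition e_ i : 'rV[R]_3 := delta_mx 0 i.

Lemma is_derive_line f y i (s : R) :
  derivable f (y + s *: e_ i) (e_ i) ->
  is_derive s (1 : R) (fun r : R => f (y + r *: e_ i)) (partial i f (y + s *: e_ i)).
Proof.
move=> df.
have E : (fun h : R => h^-1 *: (((fun r : R => f (y + r *: e_ i)) \o shift s) (h *: (1 : R))
      - f (y + s *: e_ i))) =
    (fun h : R => h^-1 *: ((f \o shift (y + s *: e_ i)) (h *: e_ i) - f (y + s *: e_ i))).
  apply/funext => h /=; congr (_ *: (f _ - _)).
  by rewrite /GRing.scale /= mulr1 -/(GRing.scale _ _) scalerDl addrCA.
by apply: DeriveDef; rewrite /derivable /derive E.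
Qed.

Lemma smooth_derivable f x i : smooth f -> derivable f x (e_ i).
Proof. by move=> /(_ [::]) [_]; exact. Qed.

Lemma smooth_continuous f : smooth f -> continuous f.
Proof. by move=> /(_ [::]) []. Qed.

Lemma smooth_partial f i : smooth f -> smooth (partial i f).
Proof. by move=> sf s; have := sf (rcons s i); rewrite foldr_rcons. Qed.

(** The mean value theorem applied twice to a second difference. *)
Lemma second_difference f x i j (h : R) : smooth f -> 0 < h ->
  exists a b, [/\ 0 < a < h, 0 < b < h &
    f (x + h *: e_ i + h *: e_ j) - f (x + h *: e_ j) - (f (x + h *: e_ i) - f x)
    = partial j (partial i f) (x + a *: e_ i + b *: e_ j) * h * h].
Proof.
move=> sf h0.
have der g y k (s : R) : smooth g ->
    is_derive s (1 : R) (fun r : R => g (y + r *: e_ k)) (partial k g (y + s *: e_ k)).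
  by move=> sg; apply: is_derive_line; exact: smooth_derivable.
have cont (g dg : R -> R) : (forall s, is_derive s (1 : R) g (dg s)) ->
    {within `[0, h], continuous g}.
  move=> H; apply: derivable_within_continuous => s _; by case: (H s).
pose G s := f (x + h *: e_ j + s *: e_ i) - f (x + s *: e_ i).
have dG s : is_derive s (1 : R) G
    (partial i f (x + h *: e_ j + s *: e_ i) - partial i f (x + s *: e_ i)).
  exact: is_deriveB (der f (x + h *: e_ j) i s sf) (der f x i s sf).
have [a] := MVT h0 (fun s _ => dG s) (cont _ _ dG).
rewrite in_itv/= => ah.
rewrite /G scale0r !addr0 subr0 [x + h *: e_ j + h *: e_ i]addrAC => Ga.
have dK s := der (partial i f) (x + a *: e_ i) j s (smooth_partial i sf).
have [b] := MVT h0 (fun s _ => dK s) (cont _ _ dK).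
rewrite in_itv/= => bh; rewrite scale0r addr0 subr0 => Kb.
exists a, b; split => //; rewrite -Kb [x + a *: e_ i + h *: e_ j]addrAC -Ga.
by ring.
Qed.

(** The second difference is symmetric in the two directions and, divided by
    [h ^ 2], tends to either mixed derivative. *)
Lemma partialC f i j : smooth f -> partial i (partial j f) = partial j (partial i f).
Proof.
have alg (p q r s u v h : R) : 0 < h ->
    p - r - (q - s) = u * h * h -> p - q - (r - s) = v * h * h -> v = u.
  move=> h0 E1 E2; have hh : h * h != 0 by rewrite mulf_neq0// gt_eqF.
  by apply: (mulIf hh); rewrite !mulrA -E1 -E2; ring.
have alg2 (p q u v e : R) : `|p - q| < e / 2 -> `|u - v| < e / 2 -> q = v -> `|p - u| <= e.
  by rewrite !ltr_norml ler_norml => H1 H2 qv; lra.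
move=> sf; apply/funext => x; apply/eqP; rewrite -subr_eq0 -normr_le0.
apply/ler_addgt0Pr => e e0; rewrite add0r.
pose P g (h : R) := forall a b : R, 0 < a < h -> 0 < b < h ->
  forall k l, `|g x - g (x + a *: e_ k + b *: e_ l)| < e / 2.
have close g : continuous g -> \forall h \near (0 : R)^'+, P g h.
  move=> cg.
  have /nbhs_ballP[d /= d0 Hd] : \forall y \near x, `|g x - g y| < e / 2.
    by move/cvgr_dist_lt : (cg x); apply; rewrite divr_gt0.
  near=> h => a b /andP[a0 ah] /andP[b0 bh] k l; apply: Hd; split=> // p q.
  have hd : h < d / 2 by near: h; apply: nbhs_right_lt; rewrite divr_gt0.
  rewrite -ball_normE /= /e_ !mxE.
  have -> : x p q - (x p q + a * ((p == 0) && (q == k))%:R + b * ((p == 0) && (q == l))%:R)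
    = - (a * ((p == 0) && (q == k))%:R + b * ((p == 0) && (q == l))%:R) by ring.
  rewrite normrN; apply: (@le_lt_trans _ _ (a + b)); last by lra.
  have c01 (c : R) (t : bool) : 0 < c -> 0 <= c * t%:R <= c.
    by case: t => c0; rewrite ?mulr1 ?mulr0 lexx ltW.
  have := c01 a ((p == 0) && (q == k)) a0; have := c01 b ((p == 0) && (q == l)) b0.
  move: (a * _) (b * _) => s t; rewrite ler_norml; lra.
have c1 := close _ (smooth_continuous (smooth_partial i (smooth_partial j sf))).
have c2 := close _ (smooth_continuous (smooth_partial j (smooth_partial i sf))).
have [h [K1 [K2 h0]]] := @filter_ex _ _ (at_right_proper_filter (0 : R)) _
  (filterI c1 (filterI c2 (nbhs_right_gt (0 : R)))).
have [a [b [ah bh E1]]] := second_difference x i j sf h0.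
have [a' [b' [ah' bh' E2]]] := second_difference x j i sf h0.
rewrite (addrAC x (h *: e_ j)) in E2.
have EQ := alg _ _ _ _ _ _ _ h0 E1 E2.
have H1 := K1 a' b' ah' bh' j i.
have H2 := K2 a b ah bh i j.
exact: alg2 H1 H2 EQ.
Unshelve. all: by end_near. Qed.
End Partial.
Section Tests.
Context {R : realType}.
Implicit Types (f g : sfield R) (x y : 'rV[R]_3) (i j k : 'I_3).

Definition tensor (b : 'I_3 -> R -> R) : sfield R := fun x => \prod_i b i (x 0 i).

Lemma is_derive_tensor (b : 'I_3 -> R -> R) x k : derivable (b k) (x 0 k) 1 ->
  is_derive x (@e_ R k) (tensor b)
    (tensor (fun i => if i == k then derive1 (b k) else b i) x).
Proof.
move=> db.
pose c := \prod_(i | i != k) b i (x 0 i).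
have -> : tensor (fun i => if i == k then derive1 (b k) else b i) x = c * 'D_1 (b k) (x 0 k).
  rewrite /tensor (bigD1 k)//= eqxx derive1E mulrC; congr (_ * _).
  by apply: eq_bigr => i /negbTE ->.
have D := is_deriveZ c (derivableP db).
have E : (fun h : R => h^-1 *: ((tensor b \o shift x) (h *: @e_ R k) - tensor b x)) =
    (fun h : R => h^-1 *: (((c \*: b k) \o shift (x 0 k)) (h *: (1 : R)) - (c \*: b k) (x 0 k))).
  apply/funext => h; congr (_ *: (_ - _)).
    rewrite /tensor /= (bigD1 k)//= mulrC; congr (_ * _).
      apply: eq_bigr => i ik; rewrite /e_ !mxE (negbTE ik) andbF mulr0.
      by rewrite add0r.
    by rewrite /e_ !mxE !eqxx.
  by rewrite /tensor (bigD1 k)//= mulrC.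
by case: D => + +; rewrite /derivable /derive -E => d1 d2; exact: DeriveDef d1 d2.
Qed.

Lemma smooth_tensor (b : 'I_3 -> R -> R) : (forall i, smooth1 (b i)) -> smooth (tensor b).
Proof.
move=> sb s.
have [c [sc ->]] : exists c : 'I_3 -> R -> R, (forall i, smooth1 (c i)) /\
    foldr (@partial R) (tensor b) s = tensor c.
  elim: s => [|k s [c [sc /= ->]]]; first by exists b.
  exists (fun i => if i == k then derive1 (c k) else c i); split.
    by move=> i; case: ifP => _ //; exact: smooth1_derive.
  apply/funext => x.
  by case: (@is_derive_tensor c x k (smooth1_derivable (sc k))).
split; last first.
  by move=> x i; case: (@is_derive_tensor c x i (smooth1_derivable (sc i))).
rewrite /tensor; elim: (index_enum _) => [|i r IH] x.
  rewrite (_ : (fun x0 => _) = cst 1); first exact: cst_continuous.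
  by apply/funext => y; rewrite big_nil.
rewrite (_ : (fun x0 => _) =
  (fun y : 'rV[R]_3 => c i (y 0 i) * \prod_(j <- r) c j (y 0 j))); last first.
  by apply/funext => y; rewrite big_cons.
apply: continuousM; last exact: IH.
apply: continuous_comp; [exact: coord_continuous|exact: smooth1_continuous].
Qed.

Lemma partial_tensor (b : 'I_3 -> R -> R) k : smooth1 (b k) ->
  partial k (tensor b) = tensor (fun i => if i == k then derive1 (b k) else b i).
Proof.
move=> sb; apply/funext => x.
by case: (@is_derive_tensor b x k (smooth1_derivable sb)).
Qed.

Lemma compact_cbox (a b : 'rV[R]_3) : compact (cbox a b).
Proof.
have -> : cbox a b = [set v | forall i, `[a 0 i, b 0 i]%classic (v ord0 i)].
  apply/seteqP; split => v H i; have := H i; rewrite /= in_itv/=.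
    by rewrite (_ : ord0 = 0)//; exact: val_inj.
  by rewrite (_ : ord0 = 0)//; exact: val_inj.
apply: (@rV_compact R 3 (fun i => `[a 0 i, b 0 i]%classic)) => i; exact: segment_compact.
Qed.

Definition bump3 n (a b : 'rV[R]_3) : sfield R :=
  tensor (fun i => bump n (a 0 i) (b 0 i)).

Lemma bump3_ge0 n a b x : 0 <= bump3 n a b x.
Proof. by apply: prodr_ge0 => i _; exact: bump_ge0. Qed.

Lemma bump3_le1 n a b x : bump3 n a b x <= 1.
Proof. by apply: prodr_ile1 => i _; rewrite bump_ge0 bump_le1. Qed.

Lemma bump3_eq0 n a b x : ~ obox a b x -> bump3 n a b x = 0.
Proof.
move=> H; have /existsNP[i Hi] := H.
by rewrite /bump3 /tensor (bigD1 i)//= bump_eq0 ?mul0r//; exact/negP.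
Qed.

Lemma bump3_cvg a b x : bump3 n a b x @[n --> \oo] --> (\1_(obox a b) x : R).
Proof.
have -> : \1_(obox a b) x = \prod_i (\1_(`](a 0 i), (b 0 i)[%classic : set R) (x 0 i) : R).
  rewrite indicE; have [|H] := boolP (x \in obox a b).
    rewrite inE => H; rewrite big1// => i _; rewrite indicE mem_set//=.
    by rewrite in_itv/=; exact: H.
  have /existsNP[i Hi] : ~ obox a b x by move=> h; rewrite mem_set in H.
  by rewrite (bigD1 i)//= indicE memNset ?mul0r//= in_itv/=.
rewrite /bump3 /tensor; elim: (index_enum _) => [|i r IH].
  rewrite big_nil (_ : (fun n => _) = cst 1); first exact: cvg_cst.
  by apply/funext => n; rewrite big_nil.
rewrite big_cons (_ : (fun n => _) = (fun n => bump n (a 0 i) (b 0 i) (x 0 i) *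
  \prod_(j <- r) bump n (a 0 j) (b 0 j) (x 0 j))).
  by apply: cvgM => //; exact: bump_cvg.
by apply/funext => n; rewrite big_cons.
Qed.

Lemma obox_sub_cbox (a b : 'rV[R]_3) : obox a b `<=` cbox a b.
Proof. by move=> x H i; have /andP[/ltW-> /ltW->] := H i. Qed.

Lemma stest_bump3 n a b (A : set 'rV[R]_3) : cbox a b `<=` A -> stest A (bump3 n a b).
Proof.
move=> abA; split.
  by apply: smooth_tensor => i; exact: smooth1_bump.
exists (cbox a b); split => //; first exact: compact_cbox.
by move=> x nx; apply: bump3_eq0 => /obox_sub_cbox.
Qed.

Lemma partial_support f i (C : set 'rV[R]_3) : compact C ->
  (forall x, ~ C x -> f x = 0) -> forall x, ~ C x -> partial i f x = 0.
Proof.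
move=> cC f0 x Cx.
have oC : open (~` C) by apply: closed_openC; apply: compact_closed => //; exact: norm_hausdorff.
have n0 : \near x, cst 0 x = f x.
  near=> y; rewrite /cst f0//.
  by near: y; exact: open_nbhs_nbhs.
by case: (near_eq_is_derive n0 (is_derive_cst 0 x (@e_ R i))).
Unshelve. all: by end_near. Qed.

Lemma stest_partial (A : set 'rV[R]_3) f i : stest A f -> stest A (partial i f).
Proof.
move=> [sf [C [cC CA f0]]]; split; first exact: smooth_partial.
exists C; split; [exact: cC|exact: CA|exact: (partial_support i cC f0)].
Qed.

Lemma vtest_grad (A : set 'rV[R]_3) f : stest A f -> vtest A (grad f).
Proof.
move=> tf i; rewrite (_ : (fun x => _) = partial i f); first exact: stest_partial.
by apply/funext => x; rewrite mxE.
Qed.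

(** This is where the symmetry of second derivatives enters. *)
Lemma ccurl_grad f : smooth f -> ccurl (grad f) = 0.
Proof.
move=> sf; apply/funext => x; apply/rowP => i; rewrite !mxE.
have E j : (fun y => grad f y 0 j) = partial j f by apply/funext => y; rewrite mxE.
by rewrite !E partialC// subrr.
Qed.

Lemma compact_sub_obox (C : set 'rV[R]_3) : compact C ->
  exists M : R, C `<=` obox (const_mx (- M)) (const_mx M).
Proof.
move=> /compact_bounded [M [_ HM]]; exists (M + 2) => x /(HM (M + 1)) H i.
have {}H : `|x| <= M + 1 by apply: H; rewrite ltrDl.
rewrite !mxE; have : `|x 0 i| <= `|x|.
  by rewrite [leRHS]mx_normrE (le_bigmax _ (fun ij => `|x ij.1 ij.2|) (0, i)).
by move/le_trans => /(_ _ H); rewrite ler_norml; lra.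
Qed.

Lemma lebesgue_itv_fin (a b : R) : lebesgue_measure `]a, b[ \is a fin_num.
Proof. by rewrite lebesgue_measure_itv/=; case: ifP => _; rewrite ?fin_numB. Qed.

Lemma vol_obox_lty (a b : 'rV[R]_3) : (vol R (@pt3 R @^-1` obox a b) < +oo)%E.
Proof.
pose I i : set (measurableTypeR R) := `]a 0 i, b 0 i[%classic.
have mI i : measurable (I i) by exact: measurable_itv.
have E1 := product_measure1E (@lebesgue_measure R \x @lebesgue_measure R)%E
  (@lebesgue_measure R) (measurableX (mI 0) (mI 1)) (mI 2).
have E2 := product_measure1E (@lebesgue_measure R) (@lebesgue_measure R) (mI 0) (mI 1).
have fin i : (@lebesgue_measure R) (I i) \is a fin_num by exact: lebesgue_itv_fin.
rewrite pt3_obox ltey_eq; apply/orP; left.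
apply: (@eq_ind_r _ _ (fun x : \bar R => x \is a fin_num) _ _ E1).
apply: fin_numM; last exact: fin.
apply: (@eq_ind_r _ _ (fun x : \bar R => x \is a fin_num) _ _ E2).
by apply: fin_numM; exact: fin.
Qed.

Lemma integrable_continuous_obox f (C : set 'rV[R]_3) (a b : 'rV[R]_3) :
  continuous f -> compact C -> obox a b `<=` C ->
  (vol R).-integrable (@pt3 R @^-1` obox a b) (EFin \o (f \o @pt3 R)).
Proof.
move=> cf cC abC.
apply: measurable_bounded_integrable.
- exact: measurable_obox.
- exact: vol_obox_lty.
- by apply: measurable_funS (measurable_continuous cf).
have : compact (f @` C).
  by apply: continuous_compact => //; exact: continuous_subspaceT.
move=> /compact_bounded[M [Mr HM]]; exists M; split => // r Mr' p abp /=.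
by apply: HM => //; exists (pt3 p) => //; exact: abC.
Qed.

Lemma integrable_continuous_compact f (C : set 'rV[R]_3) :
  continuous f -> compact C -> (forall x, ~ C x -> f x = 0) ->
  (vol R).-integrable setT (EFin \o (f \o @pt3 R)).
Proof.
move=> cf cC f0; have [M CM] := compact_sub_obox cC.
apply: (@integrable_support _ _ _ _ (@pt3 R @^-1` obox (const_mx (- M)) (const_mx M))).
- exact: measurable_obox.
- by move=> p np; apply: f0 => /CM.
apply: (integrable_continuous_obox cf (@compact_cbox (const_mx (- M)) (const_mx M))).
exact: obox_sub_cbox.
Qed.

Lemma sL2_stest (A B : set 'rV[R]_3) f : measurable (@pt3 R @^-1` A : set (R3 R)) ->
  stest B f -> sL2 A f.
Proof.
move=> mA [sf [C [cC _ f0]]]; have cf := smooth_continuous sf.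
split; first exact: measurable_funS (measurable_continuous cf).
have : (vol R).-integrable setT (EFin \o ((fun x => f x ^+ 2) \o @pt3 R)).
  apply: (integrable_continuous_compact _ cC).
    by move=> x; apply: continuousM; exact: cf.
  by move=> x nx; rewrite f0// expr0n.
by apply: integrableS.
Qed.

Lemma vL2_vtest (A B : set 'rV[R]_3) u : measurable (@pt3 R @^-1` A : set (R3 R)) ->
  vtest B u -> vL2 A u.
Proof. by move=> mA tu i; exact: (sL2_stest mA (tu i)). Qed.

End Tests.
(** * The fundamental lemma of the calculus of variations *)

Section Dynkin.
Context d d' (S : measurableType d) (T : measurableType d') (R : realType).
Variables (mu : {measure set S -> \bar R}) (F : set S) (f : S -> \bar R) (pi : S -> T).
Hypotheses (mF : measurable F) (fi : mu.-integrable F f) (mpi : measurable_fun setT pi).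

(** The sets whose preimage has integral zero form a Dynkin system, because [f] is
    integrable and has integral zero on [F] itself. *)
Lemma integral0_dynkin (G : set (set T)) :
  @measurable _ T = <<s G >> -> setI_closed G -> (\int[mu]_(x in F) f x = 0)%E ->
  (forall A, G A -> \int[mu]_(x in F `&` pi @^-1` A) f x = 0)%E ->
  forall A, measurable A -> (\int[mu]_(x in F `&` pi @^-1` A) f x = 0)%E.
Proof.
move=> mG GI F0 G0 A mA.
have mpre B : measurable B -> measurable (pi @^-1` B).
  by move=> mB; rewrite -[X in measurable X]setTI; exact: mpi.
have mFB B : measurable B -> measurable (F `&` pi @^-1` B).
  by move=> mB; apply: measurableI => //; exact: mpre.
have fB B : measurable B -> mu.-integrable (F `&` pi @^-1` B) f.
  by move=> mB; apply: (integrableS mF (mFB _ mB) _ fi); exact: subIsetl.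
have mA' : <<s G >> A by rewrite -mG.
pose P (B : set T) := (\int[mu]_(x in F `&` pi @^-1` B) f x = 0)%E.
apply: (@dynkin_induction _ _ G P mG GI _ G0 _ _ A mA'); rewrite /P.
- by rewrite preimage_setT setIT.
- move=> B mB B0.
  have mB' : measurable (~` B) by exact: measurableC.
  have FU : F = (F `&` pi @^-1` B) `|` (F `&` pi @^-1` (~` B)).
    by rewrite preimage_setC -setIUr setUCr setIT.
  have := F0; rewrite {1}FU integral_setU.
  + by rewrite B0 add0e.
  + exact: mFB.
  + exact: mFB.
  + by rewrite -FU; exact: measurable_int fi.
  + by apply/disj_setPS => x [[_ +] [_ +]].
- move=> B mB tB B0.
  rewrite preimage_bigcup setI_bigcupr integral_bigcup.
  + by rewrite eseries0// => i _ _; exact: B0.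
  + by move=> i j _ _ [x [[_ Bi] [_ Bj]]]; apply: tB => //; exists (pi x).
  + by move=> k; exact: mFB.
  + rewrite -setI_bigcupr -preimage_bigcup; apply: fB.
    exact: bigcupT_measurable.
Qed.

End Dynkin.

Section Fundamental.
Context {R : realType}.
Implicit Types (U : set 'rV[R]_3) (a b : 'rV[R]_3) (g : sfield R).

Let rays : set (set (measurableTypeR R)) := [set A | exists x, A = `]x, +oo[%classic].

Let measurable_rays : @measurable _ (measurableTypeR R) = <<s rays >>.
Proof. exact: RGenOInfty.measurableE. Qed.

Let raysI : setI_closed rays.
Proof.
move=> _ _ [x ->] [y ->]; exists (Order.max x y); apply/seteqP; split => z /=.
  by rewrite !in_itv/= !andbT gt_max => -[-> ->].
by rewrite !in_itv/= !andbT gt_max => /andP[-> ->].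
Qed.

Let setX_measurableI d1 d2 (T1 : measurableType d1) (T2 : measurableType d2) :
  setI_closed [set A `*` B | A in @measurable _ T1 & B in @measurable _ T2].
Proof.
move=> _ _ [A mA [B mB <-]] [A' mA' [B' mB' <-]].
exists (A `&` A'); first exact: measurableI.
by exists (B `&` B'); [exact: measurableI|rewrite setXI].
Qed.

Let ray_or_T (A : set R) := A = setT \/ exists x, A = `]x, +oo[%classic.

Let ray_cut (A : set R) (a b : R) : ray_or_T A ->
  exists2 a', a <= a' & forall x, A x /\ a < x < b <-> a' < x < b.
Proof.
move=> [->|[y ->]]; first by exists a => // x; split=> [[]|].
exists (Order.max a y); first by rewrite le_max lexx.
move=> x; rewrite /= in_itv/= andbT gt_max; split.
  by move=> [-> /andP[-> ->]].
by move=> /andP[/andP[-> ->] ->].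
Qed.

(** Moving the lower corner of a box inwards is intersecting it with a ray in each
    coordinate.  Rays are stable under intersection and generate the Borel sets, so
    Dynkin's theorem passes from rays to Borel sets one coordinate at a time,
    then twice from rectangles to the product sigma-algebra. *)
Lemma subbox_integral0_ae a b (f : R3 R -> \bar R) :
  let Q := @pt3 R @^-1` obox a b in
  (vol R).-integrable Q f ->
  (forall a', (forall i, a 0 i <= a' 0 i) ->
     (\int[vol R]_(p in @pt3 R @^-1` obox a' b) f p = 0)%E) ->
  ae_eq (vol R) Q f (cst 0%E).
Proof.
move=> Q fi H; have mQ : measurable Q by exact: measurable_obox.
pose cyl (A0 A1 A2 : set (measurableTypeR R)) := (A0 `*` A1) `*` A2.
pose N A0 A1 A2 := (\int[vol R]_(p in Q `&` cyl A0 A1 A2) f p = 0)%E.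
have rT (A : set R) : rays A -> ray_or_T A by right.
have rM (A : set (measurableTypeR R)) : ray_or_T A -> measurable A.
  by move=> [->//|[x ->]]; exact: measurable_itv.
have fQ (E : set (measurableTypeR R * measurableTypeR R * measurableTypeR R)) :
    measurable E -> measurable (Q `&` E) /\ (vol R).-integrable (Q `&` E) f.
  move=> mE; have mQE : measurable (Q `&` E) by exact: measurableI.
  by split => //; apply: (integrableS mQ mQE _ fi); exact: subIsetl.
have N0 A0 A1 A2 : ray_or_T A0 -> ray_or_T A1 -> ray_or_T A2 -> N A0 A1 A2.
  move=> /(@ray_cut _ (a 0 0) (b 0 0))[x0 ax0 H0].
  move=> /(@ray_cut _ (a 0 1) (b 0 1))[x1 ax1 H1].
  move=> /(@ray_cut _ (a 0 2) (b 0 2))[x2 ax2 H2].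
  pose a' : 'rV[R]_3 := \row_i nth 0 [:: x0; x1; x2] i.
  rewrite /N (_ : Q `&` _ = @pt3 R @^-1` obox a' b).
    by apply: H; apply/forall_ord3; rewrite !mxE.
  rewrite /Q !pt3_obox !mxE /=; apply/seteqP; split => p /=; rewrite !in_itv/=.
    move=> [[[? ?] ?] [[? ?] ?]].
    by split; [split|]; [apply/H0|apply/H1|apply/H2].
  by move=> [[/H0[? ?] /H1[? ?]] /H2[? ?]].
have mT := @measurableT _ (measurableTypeR R).
have N1 A0 A1 A2 : measurable A0 -> ray_or_T A1 -> ray_or_T A2 -> N A0 A1 A2.
  move=> mA0 r1 r2.
  have [m i] := fQ (cyl setT A1 A2) (measurableX (measurableX mT (rM _ r1)) (rM _ r2)).
  have E A : Q `&` cyl A A1 A2 = Q `&` cyl setT A1 A2 `&` (fst \o fst) @^-1` A.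
    by rewrite /cyl /preimage; apply/seteqP; split => p /=; tauto.
  rewrite /N E; apply: (integral0_dynkin m i _ measurable_rays raysI) => //.
  - exact: measurableT_comp.
  - by apply: N0 => //; left.
  - by move=> A /rT rA; rewrite -E; exact: N0.
have N2 A0 A1 A2 : measurable A0 -> measurable A1 -> ray_or_T A2 -> N A0 A1 A2.
  move=> mA0 mA1 r2.
  have [m i] := fQ (cyl A0 setT A2) (measurableX (measurableX mA0 mT) (rM _ r2)).
  have E A : Q `&` cyl A0 A A2 = Q `&` cyl A0 setT A2 `&` (snd \o fst) @^-1` A.
    by rewrite /cyl /preimage; apply/seteqP; split => p /=; tauto.
  rewrite /N E; apply: (integral0_dynkin m i _ measurable_rays raysI) => //.
  - exact: measurableT_comp.
  - by apply: N1 => //; left.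
  - by move=> A /rT rA; rewrite -E; exact: N1.
have N3 A0 A1 A2 : measurable A0 -> measurable A1 -> measurable A2 -> N A0 A1 A2.
  move=> mA0 mA1 mA2.
  have [m i] := fQ (cyl A0 A1 setT) (measurableX (measurableX mA0 mA1) mT).
  have E A : Q `&` cyl A0 A1 A = Q `&` cyl A0 A1 setT `&` snd @^-1` A.
    by rewrite /cyl /preimage; apply/seteqP; split => p /=; tauto.
  rewrite /N E; apply: (integral0_dynkin m i _ measurable_rays raysI) => //.
  - by apply: N2 => //; left.
  - by move=> A /rT rA; rewrite -E; exact: N2.
have N4 (A : set (measurableTypeR R * measurableTypeR R)%type) A2 :
    measurable A -> measurable A2 -> (\int[vol R]_(p in Q `&` A `*` A2) f p = 0)%E.
  move=> mA mA2.
  have [m i] := fQ (setT `*` A2) (measurableX measurableT mA2).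
  have E B : Q `&` B `*` A2 = Q `&` setT `*` A2 `&` fst @^-1` B.
    by rewrite /cyl /preimage; apply/seteqP; split => p /=; tauto.
  rewrite E; apply: (integral0_dynkin m i _ (measurable_prod_measurableType _ _)
    (@setX_measurableI _ _ _ _)) => //.
  - by have := N3 _ _ _ mT mT mA2; rewrite /N /cyl setXTT.
  - by move=> _ [B0 mB0 [B1 mB1 <-]]; rewrite -E; exact: N3.
have N5 (A : set (measurableTypeR R * measurableTypeR R * measurableTypeR R)%type) :
    measurable A -> (\int[vol R]_(p in Q `&` A) f p = 0)%E.
  move=> mA; have [m i] := fQ setT measurableT; rewrite setIT in m i.
  rewrite -[A](preimage_id); apply: (integral0_dynkin m i _ (measurable_prod_measurableType _ _)
    (@setX_measurableI _ _ _ _)) => //.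
  - by have := N4 _ _ measurableT mT; rewrite setXTT setIT.
  - by move=> _ [B0 mB0 [B1 mB1 <-]]; rewrite preimage_id; exact: N4.
apply: integral_ae_eq => // E EQ mE.
by rewrite integral0 -(setIidr EQ); exact: N5.
Qed.

(** Dominated convergence, the bumps tending to the indicator of the box. *)
Lemma bump3_test_integral0 a b g :
  (vol R).-integrable (@pt3 R @^-1` obox a b) (EFin \o (g \o @pt3 R)) ->
  (forall n, \int[vol R]_(p in @pt3 R @^-1` obox a b) (g (pt3 p) * bump3 n a b (pt3 p)) = 0) ->
  (\int[vol R]_(p in @pt3 R @^-1` obox a b) (g (pt3 p))%:E = 0)%E.
Proof.
move=> gi H; have mQ : measurable (@pt3 R @^-1` obox a b : set (R3 R)) by exact: measurable_obox.
have mg := measurable_int _ gi.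
have mb n : measurable_fun (@pt3 R @^-1` obox a b) (bump3 n a b \o @pt3 R).
  apply: measurable_funS (measurable_continuous _) => //.
  by apply: smooth_continuous; apply: smooth_tensor => i; exact: smooth1_bump.
have mgb n : measurable_fun (@pt3 R @^-1` obox a b) (fun p => (g (pt3 p) * bump3 n a b (pt3 p))%:E).
  by apply/measurable_EFinP/measurable_funM; [exact/measurable_EFinP|exact: mb].
have gbi n : (vol R).-integrable (@pt3 R @^-1` obox a b)
    (fun p => (g (pt3 p) * bump3 n a b (pt3 p))%:E).
  apply: (le_integrable mQ (mgb n) _ gi) => p _ /=.
  by rewrite lee_fin normrM ler_piMr// ger0_norm ?bump3_ge0 ?bump3_le1.
have cvg_gb : {ae vol R, forall p, (@pt3 R @^-1` obox a b) p ->
    (g (pt3 p) * bump3 n a b (pt3 p))%:E @[n --> \oo] --> (g (pt3 p))%:E}.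
  apply: aeW => p Qp; apply: cvg_EFin; first by near=> n.
  rewrite -[X in _ --> X]mulr1; apply: cvgMr.
  have := @bump3_cvg R a b (pt3 p); rewrite indicE mem_set//.
have dom : {ae vol R, forall p, forall n, (@pt3 R @^-1` obox a b) p ->
    (`|(g (pt3 p) * bump3 n a b (pt3 p))%:E| <= `|(g (pt3 p))%:E|)%E}.
  apply: aeW => p n _; rewrite lee_fin normrM ler_piMr//.
  by rewrite ger0_norm ?bump3_ge0 ?bump3_le1.
have [_ _] := dominated_convergence mQ mgb mg cvg_gb (integrable_abse gi) dom.
rewrite (_ : [sequence _]_n = cst 0%E); last first.
  apply/funext => n /=; rewrite -[LHS]fineK; first by congr EFin; exact: H.
  exact: integrable_fin_num (gbi n).
by move=> /(@cvg_unique _ (@ereal_hausdorff R) _ _ _ _ (cvg_cst _)) <-.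
Unshelve. all: by end_near. Qed.

(** Every box inside [U] has sub-boxes inside [U] again, so the integrals of [g]
    over all of them vanish; countably many rational boxes then cover [U]. *)
Lemma fundamental_lemma U g : open U ->
  (forall a b, cbox a b `<=` U ->
    (vol R).-integrable (@pt3 R @^-1` obox a b) (EFin \o (g \o @pt3 R))) ->
  (forall n a b, cbox a b `<=` U ->
    \int[vol R]_(p in @pt3 R @^-1` obox a b) (g (pt3 p) * bump3 n a b (pt3 p)) = 0) ->
  ae_on U (fun x => g x = 0).
Proof.
move=> oU gi H.
have Hbox q : cbox (@ratv R q.1) (@ratv R q.2) `<=` U ->
    ae_eq (vol R) (@pt3 R @^-1` obox (ratv q.1) (ratv q.2)) (EFin \o (g \o @pt3 R)) (cst 0%E).
  move=> qU; apply: subbox_integral0_ae; first exact: gi.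
  move=> a' aa'.
  have aU : cbox a' (@ratv R q.2) `<=` U.
    move=> x Hx; apply: qU => i; have /andP[h1 ->] := Hx i.
    by rewrite (le_trans (aa' i) h1).
  by apply: bump3_test_integral0 => [|n]; [exact: gi|exact: H].
have Hall : {ae vol R, forall p, forall n : nat,
    if unpickle n is Some q then cbox (@ratv R q.1) (@ratv R q.2) `<=` U ->
      obox (@ratv R q.1) (@ratv R q.2) (pt3 p) -> g (pt3 p) = 0 else True}.
  apply: ae_foralln => n; case: unpickle => [q|]; last exact: aeW.
  have [qU|nqU] := pselect (cbox (@ratv R q.1) (@ratv R q.2) `<=` U); last exact: aeW.
  by apply: aeS (Hbox q qU) => p Hp _ qp; have [] := Hp qp.
apply: aeS Hall => p Hp Up.
have [q [qp qU]] := open_ratbox oU Up.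
by have := Hp (pickle q); rewrite pickleK; exact.
Qed.

End Fundamental.
(** * Integration by parts for polynomials against tensor bumps *)

Section ProductIntegral.
Context d1 d2 (T1 : measurableType d1) (T2 : measurableType d2) (R : realType).
Variables (m1 : {sigma_finite_measure set T1 -> \bar R})
  (m2 : {sigma_finite_measure set T2 -> \bar R}).
Variables (f : T1 -> R) (g : T2 -> R).
Hypotheses (fi : m1.-integrable setT (EFin \o f)) (gi : m2.-integrable setT (EFin \o g)).

Lemma Rintegral_prod :
  (m1 \x m2)%E.-integrable setT (EFin \o (fun z => f z.1 * g z.2)) /\
  \int[(m1 \x m2)%E]_z (f z.1 * g z.2) = (\int[m1]_x f x) * (\int[m2]_y g y).
Proof.
have mf := (measurable_EFinP _ _).1 (measurable_int _ fi).
have mg := (measurable_EFinP _ _).1 (measurable_int _ gi).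
have mfg : measurable_fun setT (EFin \o (fun z : T1 * T2 => f z.1 * g z.2)).
  by apply/measurable_EFinP/measurable_funM; exact: measurableT_comp.
have inner (F : T1 -> R) (G : T2 -> R) x : m2.-integrable setT (EFin \o G) ->
    (\int[m2]_y (F x * G y)%:E = (F x * \int[m2]_y G y)%:E)%E.
  move=> Gi; rewrite -RintegralZl// /Rintegral fineK//.
  apply: integrable_fin_num => //.
  by apply: (integrable_eq measurableT (integrableZl measurableT (F x) Gi)).
have fgi : (m1 \x m2)%E.-integrable setT (EFin \o (fun z => f z.1 * g z.2)).
  apply/(integrable12ltyP _ _ mfg).
  have fa : m1.-integrable setT (EFin \o (fun x => `|f x|)) by exact: integrable_norm.
  have ga : m2.-integrable setT (EFin \o (fun x => `|g x|)) by exact: integrable_norm.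
  under eq_integral => x _.
    under eq_integral do rewrite /= normrM.
    rewrite (inner (fun x => `|f x|) (fun x => `|g x|) x ga).
    over.
  have := integrableZr measurableT (\int[m2]_y `|g y|) fa.
  move=> H; have := integrable_fin_num measurableT H.
  by rewrite fin_numElt => /andP[_]; congr (_ < _)%E; apply: eq_integral.
split => //.
rewrite -RintegralZr// /Rintegral -integral12_prod_meas1// /fubini_F.
by congr fine; apply: eq_integral => x _ /=; rewrite inner.
Qed.

End ProductIntegral.

Section Area.
Context {R : realType}.
Notation mu := (@lebesgue_measure R).

(** The plane measure under a name of its own, to carry the sigma-finiteness
    that the application of Fubini to the outer product relies on. *)
Definition area : set (measurableTypeR R * measurableTypeR R)%type -> \bar R :=
  (mu \x mu)%E.

HB.instance Definition _ := measure_function.Measure.copy area (mu \x mu)%E.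

Let area_sigma_finite : sigma_finite setT area.
Proof.
pose I (n : nat) : set (measurableTypeR R) := `]- n%:R, n%:R[%classic.
have mI n : measurable (I n) by exact: measurable_itv.
exists (fun n => I n `*` I n).
  apply/seteqP; split => // -[x y] _.
  have /archi_boundP H : 0 <= `|x| + `|y| by rewrite addr_ge0.
  exists (Num.bound (`|x| + `|y|)) => //; split; rewrite /I /= in_itv/= -ltr_norml.
    by apply: le_lt_trans H; rewrite lerDl.
  by apply: le_lt_trans H; rewrite lerDr.
move=> n; split; first exact: measurableX.
rewrite ltey_eq; apply/orP; left.
apply: (@eq_ind_r _ _ (fun x : \bar R => x \is a fin_num) _ _ (product_measure1E _ _ (mI n) (mI n))).
by apply: fin_numM; exact: lebesgue_itv_fin.
Qed.

HB.instance Definition _ :=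
  Measure_isSigmaFinite.Build _ _ _ area area_sigma_finite.

End Area.

Section Parts.
Context {R : realType}.
Notation mu := (@lebesgue_measure R).
Implicit Types (b : 'I_3 -> R -> R) (P : mpoly 3 R).

Lemma prod_ord3 (F : 'I_3 -> R) : \prod_i F i = F 0 * F 1 * F 2.
Proof.
rewrite !big_ord_recr big_ord0/= mul1r.
by congr (F _ * F _ * F _); exact: val_inj.
Qed.

Lemma Rintegral_tensor b : (forall i, mu.-integrable setT (EFin \o b i)) ->
  \int[vol R]_p tensor b (pt3 p) = \prod_i \int[mu]_x b i x.
Proof.
move=> bi.
have [i2 e2] := Rintegral_prod (bi 0) (bi 1).
have [i3 e3] := @Rintegral_prod _ _ _ _ R area mu _ _ i2 (bi 2).
rewrite prod_ord3 -e2 -e3; apply: eq_Rintegral => p _; rewrite /tensor prod_ord3.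
by have [-> -> ->] := pt3E p.
Qed.

Lemma derive1_support (f : R -> R) lo hi : (forall x, ~ (lo <= x <= hi) -> f x = 0) ->
  forall x, ~ (lo <= x <= hi) -> derive1 f x = 0.
Proof.
move=> f0 x H; rewrite derive1E.
have n0 : \near x, cst 0 x = f x.
  have oC : open (~` [set` `[lo, hi]]) by apply: closed_openC; exact: itv_closed.
  near=> y; rewrite /cst f0//.
  have : (~` [set` `[lo, hi]]) y.
    by near: y; apply: open_nbhs_nbhs; split => //; rewrite /= in_itv.
  by rewrite /= in_itv.
by case: (near_eq_is_derive n0 (is_derive_cst 0 x (1 : R))).
Unshelve. all: by end_near. Qed.

Lemma Rintegral_derive0 (f : R -> R) lo hi : smooth1 f ->
  (forall x, ~ (lo <= x <= hi) -> f x = 0) -> \int[mu]_x derive1 f x = 0.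
Proof.
move=> sf f0.
pose a := Order.min lo hi - 1; pose b := Order.max lo hi + 1.
have alo : a < lo by rewrite /a ltrBlDr ltr_pwDr// ge_min lexx.
have bhi : hi < b by rewrite /b ltr_pwDr// le_max lexx orbT.
have ab : a < b.
  have : Order.min lo hi <= Order.max lo hi by rewrite ge_min !le_max lexx.
  by rewrite /a /b; lra.
have fo := derive1_support f0.
have cf := smooth1_continuous sf.
have cdf := smooth1_continuous (smooth1_derive sf).
have FTC : (\int[mu]_(x in `[a, b]) (derive1 f x)%:E)%E = ((f b)%:E - (f a)%:E)%E.
  apply: continuous_FTC2 => //.
  - exact: continuous_subspaceT.
  - split; first by move=> x _; exact: smooth1_derivable.
      by apply: cvg_at_right_filter; exact: cf.
    by apply: cvg_at_left_filter; exact: cf.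
rewrite -(@Rintegral_support _ _ _ mu [set` `[a, b]]); last first.
  move=> x; rewrite /= in_itv/= => H; apply: fo => /andP[h1 h2]; apply: H.
  by rewrite (le_trans (ltW alo) h1) (le_trans h2 (ltW bhi)).
rewrite /Rintegral FTC !f0 ?subee//; apply/negP.
  by rewrite negb_and -!ltNge alo.
by rewrite negb_and -!ltNge bhi orbT.
Qed.

Lemma smooth1_exp k : smooth1 (fun x : R => x ^+ k).
Proof.
elim: k => [|k IH] n; first by under eq_fun do rewrite expr0; exact: ndiff_cst.
under eq_fun do rewrite exprS; apply: ndiffM; last exact: IH.
elim: n {IH} => [|n IH]; first by split.
split=> //; rewrite (_ : derive1 _ = (fun=> 1 : R)); first exact: ndiff_cst.
by apply/funext => x; rewrite derive1E; case: (is_derive_id x (1 : R)).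
Qed.

Lemma derive1_expM k (f : R -> R) x : smooth1 f ->
  derive1 (fun t => t ^+ k * f t) x = x ^+ k * derive1 f x + k%:R * (x ^+ k.-1 * f x).
Proof.
move=> sf.
have := is_deriveM (is_deriveX k (is_derive_id x (1 : R)))
  (derivableP (smooth1_derivable (t := x) sf)).
rewrite exprfctE => -[_]; rewrite derive1E => ->; rewrite -derive1E /GRing.scale/= mulr1.
by congr (_ + _); ring.
Qed.

Lemma meval_continuous P : continuous (fun x : 'rV[R]_3 => meval (x 0) P).
Proof.
elim/mpolyind : P => [|k m P _ _ IH] x.
  rewrite (_ : (fun x => _) = cst 0); first exact: cst_continuous.
  by apply/funext => y; rewrite meval0.
rewrite (_ : (fun x => _) =
  (fun y => k * tensor (fun i t => t ^+ m i) y + meval (y 0) P)); last first.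
  by apply/funext => y; rewrite mevalD mevalZ mevalX.
have c1 : {for x, continuous (fun y : 'rV[R]_3 => k * tensor (fun i t => t ^+ m i) y)}.
  apply: continuousM; first exact: cst_continuous.
  by apply: smooth_continuous; apply: smooth_tensor => i; exact: smooth1_exp.
exact: (cvgD c1 (IH x)).
Qed.

Lemma integrable_polyM P (f : sfield R) (C : set 'rV[R]_3) :
  continuous f -> compact C -> (forall x, ~ C x -> f x = 0) ->
  (vol R).-integrable setT (EFin \o (fun p => meval ((pt3 p) 0) P * f (pt3 p))).
Proof.
move=> cf cC f0.
apply: (@integrable_continuous_compact R (fun x => meval (x 0) P * f x) C) => //.
  by move=> x; apply: continuousM; [exact: meval_continuous|exact: cf].
by move=> x nx; rewrite f0// mulr0.
Qed.

(** Both sides are linear in the polynomial, and for a monomial the integrals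
    factor into integrals over the line. *)
Lemma polynomial_parts P i n (lo hi : 'rV[R]_3) :
  \int[vol R]_p (meval ((pt3 p) 0) P * partial i (bump3 n lo hi) (pt3 p)) =
  - \int[vol R]_p (meval ((pt3 p) 0) (mderiv i P) * bump3 n lo hi (pt3 p)).
Proof.
have sb j : smooth1 (bump n (lo 0 j) (hi 0 j)) by exact: smooth1_bump.
have cC := @compact_cbox R lo hi.
have f0 x : ~ cbox lo hi x -> bump3 n lo hi x = 0.
  by move=> nx; apply: bump3_eq0 => /obox_sub_cbox.
have df0 := partial_support i cC f0.
have sm : smooth (bump3 n lo hi) by exact: smooth_tensor.
have cf := smooth_continuous sm.
have cdf := smooth_continuous (smooth_partial i sm).
elim/mpolyind : P => [|k m P _ _ IH].
  rewrite mderiv0; under eq_Rintegral do rewrite meval0 mul0r.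
  rewrite Rintegral_cst//= mul0r.
  under eq_Rintegral do rewrite meval0 mul0r.
  by rewrite Rintegral_cst//= mul0r oppr0.
have split_int (Q1 Q2 : mpoly 3 R) (f : sfield R) : continuous f ->
    (forall x, ~ cbox lo hi x -> f x = 0) ->
    \int[vol R]_p (meval ((pt3 p) 0) (k *: Q1 + Q2) * f (pt3 p)) =
    k * \int[vol R]_p (meval ((pt3 p) 0) Q1 * f (pt3 p)) +
    \int[vol R]_p (meval ((pt3 p) 0) Q2 * f (pt3 p)).
  move=> cg g0; have I1 := integrable_polyM Q1 cg cC g0.
  have I2 := integrable_polyM Q2 cg cC g0.
  rewrite -RintegralZl// -RintegralD//.
    by apply: eq_Rintegral => p _; rewrite mevalD mevalZ; ring.
  by apply: (integrable_eq measurableT (integrableZl measurableT k I1)).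
rewrite mderivD mderivZ !split_int// {}IH opprD -mulrN; congr (k * _ + _).
rewrite mderivX.
pose B j := bump n (lo 0 j) (hi 0 j).
pose M l j (t : R) := t ^+ (l j) * B j t.
have sM (l : 'I_3 -> nat) j : smooth1 (M l j) := smooth1M (smooth1_exp (l j)) (sb j).
have iM (l : 'I_3 -> nat) j : mu.-integrable setT (EFin \o M l j).
  apply: (@integrableT_cc R (lo 0 j) (hi 0 j)).
    exact: smooth1_continuous.
  by move=> x nx; rewrite /M /B bump_support ?mulr0.
(* In the [i]-th factor of the monomial either the bump or the power is
   differentiated; the other factors are common to both sides.  The
   truncated predecessor is harmless, its coefficient being [m i]. *)
pose m' j := if j == i then (m j).-1 else m j.
pose D j (t : R) := if j == i then t ^+ m i * derive1 (B i) t else M m j t.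
have iD j : mu.-integrable setT (EFin \o D j).
  rewrite /D; case: eqP => _; last exact: iM.
  apply: (@integrableT_cc R (lo 0 i) (hi 0 i)).
    exact: smooth1_continuous (smooth1M (smooth1_exp (m i)) (smooth1_derive (sb i))).
  move=> x nx; rewrite (derive1_support _ nx) ?mulr0//.
  by move=> y; exact: bump_support.
have -> : \int[vol R]_p (meval ((pt3 p) 0) (mpolyX R m) * partial i (bump3 n lo hi) (pt3 p)) =
    \prod_j \int[mu]_x D j x.
  rewrite -Rintegral_tensor//; apply: eq_Rintegral => p _.
  rewrite mevalX partial_tensor// /tensor -big_split/=; apply: eq_bigr => j _.
  by rewrite /D /M /B; case: eqP => [->|].
have HE (x : 'rV[R]_3) : meval (x 0) (mpolyX R (mnm_sub m (mnm1 i))) * bump3 n lo hi x = tensor (M m') x.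
  rewrite mevalX /tensor -big_split/=; apply: eq_bigr => j _.
  rewrite mnmBE mnm1E /M /m' eq_sym; case: eqP => _; first by rewrite subn1.
  by rewrite subn0.
have iT : (vol R).-integrable setT (EFin \o (tensor (M m') \o @pt3 R)).
  apply: (integrable_eq measurableT (integrable_polyM (mpolyX R (mnm_sub m (mnm1 i))) cf cC f0)).
  by move=> p _; rewrite /= HE.
have -> : \int[vol R]_p (meval ((pt3 p) 0) ((m i)%:R *: mpolyX R (mnm_sub m (mnm1 i))) *
    bump3 n lo hi (pt3 p)) = (m i)%:R * \prod_j \int[mu]_x M m' j x.
  rewrite -Rintegral_tensor// -RintegralZl//.
  by apply: eq_Rintegral => p _; rewrite mevalZ -mulrA HE.
have E1 : \int[mu]_x D i x = - ((m i)%:R * \int[mu]_x M m' i x).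
  apply/eqP; rewrite -addr_eq0; apply/eqP.
  rewrite -RintegralZl// -RintegralD//; last first.
    by apply: (integrable_eq measurableT (integrableZl measurableT (m i)%:R (iM m' i))).
  rewrite -[RHS](@Rintegral_derive0 (fun t => t ^+ m i * B i t) (lo 0 i) (hi 0 i)).
  - by apply: eq_Rintegral => t _; rewrite /D /M /m' eqxx (derive1_expM _ _ (sb i)).
  - exact: (sM (fun j => m j) i).
  - by move=> x nx; rewrite /B bump_support ?mulr0.
rewrite [LHS](bigD1 i)//= E1 [in RHS](bigD1 i)//= mulNr -mulrA.
congr (- (_ * (_ * _))); apply: eq_bigr => j /negbTE ji.
by apply: eq_Rintegral => t _; rewrite /D /M /m' ji.
Qed.

End Parts.
(** * Mesh cells lie in a Lipschitz domain *)

Section Lipschitz.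
Context {R : realType}.
Implicit Types (A : set 'rV[R]_3) (x y u : 'rV[R]_3).

Lemma lipschitz_continuous (V : normedModType R) (g : V -> R) :
  lipschitz g -> continuous g.
Proof.
move=> [M [_ HM]] x; pose L := Order.max M 0 + 1.
have L0 : 0 < L by rewrite /L ltr_pwDr// le_max lexx orbT.
have gL (y : V) : `|g x - g y| <= L * `|x - y|.
  by apply: (HM L _ (x, y)) => //; rewrite /L ltr_pwDr// le_max lexx.
apply/cvgrPdist_lt => e e0; near=> y.
apply: le_lt_trans (gL y) _; rewrite mulrC -ltr_pdivlMr//.
by near: y; apply: cvgr_dist_lt; rewrite ?divr_gt0.
Unshelve. all: by end_near. Qed.

Lemma enorm_lt u (r : R) : `|u| < r / 2 -> enorm u < r.
Proof.
move=> ur; have r0 : 0 < r by have := le_lt_trans (normr_ge0 u) ur; lra.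
have coord i : `|u 0 i| < r / 2.
  apply: le_lt_trans ur.
  by rewrite [leRHS]mx_normrE (le_bigmax _ (fun ij => `|u ij.1 ij.2|) (0, i)).
have sq i : u 0 i * u 0 i <= (r / 2) ^+ 2.
  by have := coord i; rewrite ltr_norml => /andP[h1 h2]; nra.
rewrite /enorm -[ltRHS]ger0_norm ?ltW// -sqrtr_sqr ltr_sqrt ?exprn_gt0//.
rewrite /dot; apply: (@le_lt_trans _ _ (\sum_(i < 3) (r / 2) ^+ 2)).
  by apply: ler_sum => i _; exact: sq.
by rewrite big_const_ord iter_addr_0 -mulr_natl; nra.
Qed.

Lemma mulmx_coord_continuous (Q : 'M[R]_3) j : continuous (fun y : 'rV[R]_3 => (y *m Q) 0 j).
Proof.
move=> y; rewrite (_ : (fun y => _) = (fun y : 'rV[R]_3 => \sum_(i <- index_enum 'I_3) y 0 i * Q i j)).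
  elim: (index_enum _) => [|i r IH].
    rewrite (_ : (fun y => _) = cst 0); first exact: cst_continuous.
    by apply/funext => z; rewrite big_nil.
  rewrite (_ : (fun y => _) = (fun z : 'rV[R]_3 => z 0 i * Q i j + \sum_(k <- r) z 0 k * Q k j)).
    have c1 : {for y, continuous (fun z : 'rV[R]_3 => z 0 i * Q i j)}.
      by apply: continuousM; [exact: coord_continuous|exact: cst_continuous].
    exact: (cvgD c1 IH).
  by apply/funext => z; rewrite big_cons.
by apply/funext => z; rewrite mxE.
Qed.

(** Just below the graph one leaves the closure of the domain, so a boundary
    point is never interior to the closure. *)
Lemma interior_closure_lipschitz A : open A -> lipschitz_boundary A ->
  interior (closure A) `<=` A.
Proof.
move=> oA lA x icA; apply: contrapT => nAx.
have [|Q [g [r [QQ lg r0 H]]]] := lA x.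
  by split; [exact: interior_subset|move/interior_subset].
have cg := lipschitz_continuous lg.
pose U := interior (closure A) `&` ball x (r / 2).
have oU : nbhs x U.
  apply: filterI; first by apply: open_nbhs_nbhs; split => //; exact: open_interior.
  by apply: nbhsx_ballx; rewrite divr_gt0.
have inB y : ball x (r / 2) y -> enorm (y - x) < r.
  by rewrite -ball_normE /= distrC => /enorm_lt.
have gx : (x *m Q) 0 2 <= g ((x *m Q) 0 0, (x *m Q) 0 1).
  rewrite leNgt; apply/negP => /(H x _).2 Ax; apply: nAx; apply: Ax.
  by rewrite subrr enorm_lt// normr0 divr_gt0.
(* the upward direction of the graph, in the original coordinates *)
pose e : 'rV[R]_3 := delta_mx 0 2 *m Q^T.
have eQ : e *m Q = delta_mx 0 2 by rewrite -mulmxA (mulmx1C QQ) mulmx1.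
have [s [s0 Us]] : exists s : R, 0 < s /\ U (x - s *: e).
  have /nbhs_ballP[d /= d0 Hd] := oU.
  have e0 : 0 < `|e| + 1 by rewrite ltr_pwDr.
  exists (d / (`|e| + 1)); split; first by rewrite divr_gt0.
  apply: Hd; rewrite -ball_normE /= opprB addrCA subrr addr0 normrZ.
  rewrite gtr0_norm ?divr_gt0// mulrAC ltr_pdivrMr// ltr_pM2l//.
  by rewrite ltrDl.
have yQ j : ((x - s *: e) *m Q) 0 j = (x *m Q) 0 j - s * (j == 2)%:R.
  by rewrite mulmxBl -scalemxAl eQ !mxE /= eq_sym.
have [y [Ay [Uy yg]]] : exists y, A y /\ U y /\ (y *m Q) 0 2 < g ((y *m Q) 0 0, (y *m Q) 0 1).
  have [clA Bs] := Us.
  pose hgt (y : 'rV[R]_3) : R := g ((y *m Q) 0 0, (y *m Q) 0 1) - (y *m Q) 0 2.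
  have chgt : continuous hgt.
    move=> y.
    have c1 : {for y, continuous (fun y : 'rV[R]_3 => ((y *m Q) 0 0, (y *m Q) 0 1))}.
      exact: (cvg_pair (@mulmx_coord_continuous Q 0 y) (@mulmx_coord_continuous Q 1 y)).
    have c2 := continuous_comp c1 (cg _).
    exact: (cvgB c2 (@mulmx_coord_continuous Q 2 y)).
  have nW : nbhs (x - s *: e) (U `&` [set y | 0 < hgt y]).
    apply: filterI.
      apply: filterI; first by apply: open_nbhs_nbhs; split => //; exact: open_interior.
      by apply: open_nbhs_nbhs; split => //; exact: ball_open.
    have : hgt y @[y --> x - s *: e] --> hgt (x - s *: e) by exact: chgt.
    move=> /cvgr_gt; apply; rewrite /hgt !yQ /= !mulr0 !subr0 mulr1.
    by rewrite subr_gt0; apply: lt_le_trans gx; rewrite ltrBlDr ltrDl.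
  have [y [Ay [Uy hy]]] := interior_subset clA _ nW.
  by exists y; split => //; split => //; rewrite -subr_gt0.
have [_ By] := Uy.
by have := (H y (inB y By)).1 Ay; rewrite ltNge (ltW yg).
Qed.
End Lipschitz.
(** * The curl of a Nedelec field is a Raviart-Thomas field *)

Section Curl.
Context {R : realType}.
Implicit Types (A : set 'rV[R]_3) (v w : vfield R).

Lemma msize_leP (p : mpoly 3 R) k : (forall m, m \in msupp p -> (mdeg m < k)%N) -> (msize p <= k)%N.
Proof. by move=> H; rewrite msizeE; apply/bigmax_leqP_seq => m mp _; exact: H. Qed.

Lemma msizeD_le (p q : mpoly 3 R) k : (msize p <= k)%N -> (msize q <= k)%N -> (msize (p + q) <= k)%N.
Proof. by move=> pk qk; apply: leq_trans (mmeasureD_le _ _ _) _; rewrite geq_max pk. Qed.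

Lemma msizeB_le (p q : mpoly 3 R) k : (msize p <= k)%N -> (msize q <= k)%N -> (msize (p - q) <= k)%N.
Proof. by move=> pk qk; apply: msizeD_le => //; rewrite mmeasureN. Qed.

Lemma msize_mderiv (p : mpoly 3 R) i k : (msize p <= k.+1)%N -> (msize (mderiv i p) <= k)%N.
Proof.
move=> pk; apply: msize_leP => m.
rewrite mcoeff_msupp mcoeff_deriv => nz.
have : mnm_add m (mnm1 i) \in msupp p.
  by rewrite mcoeff_msupp; apply: contra_neq nz => ->; rewrite mul0rn.
move=> /msize_mdeg_lt; rewrite mdegD mdeg1 addn1 => h.
by rewrite -ltnS; exact: leq_trans h pk.
Qed.

(** The degree is [k + 1] at most, and [msize] exceeds the degree by one. *)
Lemma msize_XM_dhomog (p : mpoly 3 R) i k : p \is ishomog1 k mdeg ->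
  (msize (mpolyX R (mnm1 i) * p) <= k.+2)%N.
Proof.
move=> hp; apply: msize_leP => m.
have hX : mpolyX R (mnm1 i) \is ishomog1 1 mdeg by rewrite dhomogX; apply/eqP; exact: mdeg1.
by move=> /(dhomog_mf (dhomogM hX hp)) ->; rewrite add1n.
Qed.

Lemma nedelec_poly k v : nedelec k v -> exists P : 'I_3 -> mpoly 3 R,
  (forall i, (msize (P i) <= k.+2)%N) /\ forall x i, v x 0 i = meval (x 0) (P i).
Proof.
move=> [p [q [Hp Hq Hv]]].
have [P HP] := choice Hp; have [Q HQ] := choice Hq.
exists (fun i => P i + (mpolyX R (mnm1 (i + 1)) * Q (i + 2) -
                        mpolyX R (mnm1 (i + 2)) * Q (i + 1))); split => [i|x i].
  have [h1 _] := HP i; apply: msizeD_le; first by apply: leq_trans h1 _.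
  by apply: msizeB_le; apply: msize_XM_dhomog; [case: (HQ (i + 2))|case: (HQ (i + 1))].
rewrite Hv !mxE mevalD mevalB !mevalM !mevalXU.
by have [_ ->] := HP i; have [_ ->] := HQ (i + 1); have [_ ->] := HQ (i + 2).
Qed.

Definition curl_poly (P : 'I_3 -> mpoly 3 R) (i : 'I_3) : mpoly 3 R :=
  mderiv (i + 1) (P (i + 2)) - mderiv (i + 2) (P (i + 1)).

Definition poly_field (P : 'I_3 -> mpoly 3 R) : vfield R :=
  fun x => \row_i meval (x 0) (P i).

Lemma poly_field_raviart_thomas P k : (forall i, (msize (P i) <= k.+1)%N) ->
  raviart_thomas k (poly_field P).
Proof.
move=> HP; exists (poly_field P), (fun=> 0); split => [i||x].
- by exists (P i); split => // x; rewrite mxE.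
- by exists 0; split; [exact: dhomog0|move=> x; rewrite meval0].
- by rewrite scale0r addr0.
Qed.

(** The gradient of a test function is a test field without curl. *)
Lemma is_weak_curl_div0 A v w : measurable (@pt3 R @^-1` A : set (R3 R)) ->
  is_weak_curl A v w -> is_weak_div A w (fun=> 0).
Proof.
move=> mA [wL2 H]; split=> [|phi tphi]; first exact: sL2_cst0.
rewrite -H; last exact: vtest_grad.
rewrite ccurl_grad; last by case: tphi.
by rewrite vinnerC (vinner0l mA) (sinner0l mA) oppr0.
Qed.

(** The test fields [phi e_j] single out one component of a weak curl. *)
Lemma dot_ccurl_axis (u : 'rV[R]_3) (phi : sfield R) (j : 'I_3) (x : 'rV[R]_3) :
  dot u (ccurl (fun y => phi y *: @e_ R j) x) =
  u 0 (j + 1) * partial (j + 2) phi x - u 0 (j + 2) * partial (j + 1) phi x.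
Proof.
have D k l : partial l (fun y => (phi y *: @e_ R j) 0 k) x = (k == j)%:R * partial l phi x.
  have [->|kj] := eqVneq k j.
    rewrite mul1r; congr (partial l _ x); apply/funext => y.
    by rewrite /e_ !mxE !eqxx mulr1.
  rewrite mul0r (_ : (fun y => _) = cst 0); first exact: derive_cst.
  by apply/funext => y; rewrite /e_ !mxE (negbTE kj) andbF mulr0.
have one_term (F : 'I_3 -> R) (l : 'I_3) : \sum_(i < 3) (i == l)%:R * F i = F l.
  rewrite (bigD1 l)//= eqxx mul1r big1 ?addr0// => i /negbTE ->.
  by rewrite mul0r.
have E1 (i : 'I_3) : (i + 1 == j) = (i == j + 2).
  by move: i j {D} => [[|[|[|//]]] ?] [[|[|[|//]]] ?].
have E2 (i : 'I_3) : (i + 2 == j) = (i == j + 1).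
  by move: i j {D E1} => [[|[|[|//]]] ?] [[|[|[|//]]] ?].
have -> : dot u (ccurl (fun y => phi y *: @e_ R j) x) =
    \sum_(i < 3) (i == j + 1)%:R * (u 0 i * partial (i + 1) phi x) -
    \sum_(i < 3) (i == j + 2)%:R * (u 0 i * partial (i + 2) phi x).
  rewrite -sumrB; apply: eq_bigr => i _; rewrite mxE !D E1 E2.
  by rewrite mulrBr !(mulrCA _ (u 0 i)).
rewrite !one_term -!addrA; congr (_ * partial _ _ _ - _ * partial _ _ _); exact: val_inj.
Qed.

Lemma smooth_cst0 : smooth (fun=> 0 : R).
Proof.
move=> s; have -> : foldr (@partial R) (fun=> 0) s = cst 0.
  elim: s => [//|i s /= ->]; apply/funext => x; exact: derive_cst.
by split; [move=> x; exact: cst_continuous|move=> x i; exact: derivable_cst].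
Qed.

Lemma vtest_axis A (phi : sfield R) j : stest A phi -> vtest A (fun y => phi y *: @e_ R j).
Proof.
move=> tphi k; have [->|kj] := eqVneq k j.
  rewrite (_ : (fun x => _) = phi)//.
  by apply/funext => y; rewrite /e_ !mxE !eqxx mulr1.
rewrite (_ : (fun x => _) = (fun=> 0)).
  split; first exact: smooth_cst0.
  by exists set0; split => //; exact: compact0.
by apply/funext => y; rewrite /e_ !mxE (negbTE kj) andbF mulr0.
Qed.

Lemma sL2_integrable_obox A f (a b : 'rV[R]_3) : measurable (@pt3 R @^-1` A : set (R3 R)) ->
  obox a b `<=` A -> sL2 A f ->
  (vol R).-integrable (@pt3 R @^-1` obox a b) (EFin \o (f \o @pt3 R)).
Proof.
move=> mA abA [mf f2]; have mQ := @measurable_obox R a b.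
have QA : @pt3 R @^-1` obox a b `<=` @pt3 R @^-1` A by move=> p; exact: abA.
have i1 : (vol R).-integrable (@pt3 R @^-1` obox a b) (EFin \o (cst 1 \o @pt3 R)).
  apply: (integrable_continuous_obox _ (@compact_cbox R a b)); last exact: obox_sub_cbox.
  exact: cst_continuous.
have i2 := integrableS mA mQ QA f2.
apply: (le_integrable mQ _ _ (integrableD mQ i1 i2)).
  by apply/measurable_EFinP; exact: measurable_funS mf.
move=> p _ /=; rewrite lee_fin [leRHS]ger0_norm ?addr_ge0 ?sqr_ge0//.
move: (f _) => t; rewrite ler_norml; have := sqr_ge0 (t - 1); have := sqr_ge0 (t + 1).
by move=> *; apply/andP; split; nra.
Qed.

(** Tested against [phi e_j] for a bump [phi] supported in [U], the field [v] is as
    good as its polynomial, which can be integrated by parts; the fundamental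
    lemma then compares the components. *)
Lemma weak_curl_polynomial A U v w P : measurable (@pt3 R @^-1` A : set (R3 R)) ->
  open U -> U `<=` A -> vL2 A v -> is_weak_curl A v w ->
  ae_on U (fun x => v x = poly_field P x) ->
  ae_on U (fun x => w x = poly_field (curl_poly P) x).
Proof.
move=> mA oU UA vL [wL Hw] vP.
suff H j : ae_on U (fun x => w x 0 j - meval (x 0) (curl_poly P j) = 0).
  apply: aeS (aeI (H 0) (aeI (H 1) (H 2))) => p [H0 [H1 H2]] Up.
  apply/rowP; apply/forall_ord3; rewrite !mxE.
  by split; apply/eqP; rewrite -subr_eq0; apply/eqP; [exact: H0|exact: H1|exact: H2].
have cpoly (Q : mpoly 3 R) : continuous (fun x : 'rV[R]_3 => meval (x 0) Q).
  exact: meval_continuous.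
have mpoly_meas (Q : mpoly 3 R) : measurable_fun setT (fun p : R3 R => meval ((pt3 p) 0) Q).
  exact: (measurable_continuous (cpoly Q)).
have oboxA a b : cbox a b `<=` U -> obox a b `<=` A.
  by move=> abU x /obox_sub_cbox /abU /UA.
have iw a b : cbox a b `<=` U ->
    (vol R).-integrable (@pt3 R @^-1` obox a b) (EFin \o ((fun x => w x 0 j) \o @pt3 R)).
  by move=> abU; apply: (sL2_integrable_obox mA (oboxA _ _ abU)); exact: wL.
have ip a b Q : (vol R).-integrable (@pt3 R @^-1` obox a b)
    (EFin \o ((fun x => meval (x 0) Q) \o @pt3 R)).
  apply: (integrable_continuous_obox (cpoly Q) (@compact_cbox R a b)).
  exact: obox_sub_cbox.
apply: fundamental_lemma => // [a b abU|n a b abU].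
  have mQ := @measurable_obox R a b.
  by apply: (integrable_eq mQ (integrableB mQ (iw a b abU) (ip a b (curl_poly P j)))).
pose phi := bump3 n a b.
have tphi : stest U phi by exact: stest_bump3.
have sphi : smooth phi by case: tphi.
have phi0 x : ~ cbox a b x -> phi x = 0.
  by move=> nx; apply: bump3_eq0 => /obox_sub_cbox.
have dphi0 i x : ~ cbox a b x -> partial i phi x = 0.
  exact: (partial_support i (@compact_cbox R a b) phi0).
have tA : stest A phi by exact: stest_bump3 (subset_trans abU UA).
have cphi := smooth_continuous sphi.
have cdphi i := smooth_continuous (smooth_partial i sphi).
have cC := @compact_cbox R a b.
pose D := @pt3 R @^-1` A; pose Q := @pt3 R @^-1` obox a b.
have mQ : measurable Q by exact: measurable_obox.
have QD : Q `<=` D by move=> p; exact: (oboxA _ _ abU).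
have cboxD (p : R3 R) : ~ D p -> ~ cbox a b (pt3 p) by move=> + /abU /UA.
have oboxQ (p : R3 R) : ~ Q p -> phi (pt3 p) = 0 by move=> np; exact: bump3_eq0.
have E1 : vinner A w (fun y => phi y *: @e_ R j) =
    \int[vol R]_p (w (pt3 p) 0 j * phi (pt3 p)).
  rewrite -(@Rintegral_support _ _ _ (vol R) D); last first.
    by move=> p np; rewrite phi0 ?mulr0//; exact: cboxD.
  apply: eq_Rintegral => p _; rewrite /dot (bigD1 j)//= big1 ?addr0.
    by rewrite /e_ !mxE !eqxx mulr1.
  by move=> i /negbTE ij; rewrite /e_ !mxE ij andbF !mulr0.
have iPd i l := integrable_polyM (P i) (cdphi l) cC (dphi0 l).
have iPphi q := integrable_polyM q cphi cC phi0.
have E2 : vinner A v (ccurl (fun y => phi y *: @e_ R j)) =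
    \int[vol R]_p (meval ((pt3 p) 0) (P (j + 1)) * partial (j + 2) phi (pt3 p) -
                   meval ((pt3 p) 0) (P (j + 2)) * partial (j + 1) phi (pt3 p)).
  rewrite -(@Rintegral_support _ _ _ (vol R) D); last first.
    by move=> p np; rewrite !dphi0 ?mulr0 ?subr0//; exact: cboxD.
  rewrite /vinner /intg /Rintegral; congr fine.
  have mD l : measurable_fun D (fun p : R3 R => partial l phi (pt3 p)).
    exact: measurable_funS (measurable_continuous (cdphi l)).
  apply: ae_eq_integral => //.
  - apply/measurable_EFinP.
    rewrite (_ : (fun p : R3 R => _) = (fun p : R3 R => v (pt3 p) 0 (j + 1) * partial (j + 2) phi (pt3 p) -
        v (pt3 p) 0 (j + 2) * partial (j + 1) phi (pt3 p))).
      by apply: measurable_funB; apply: measurable_funM; [case: (vL (j + 1))|exact: mD|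
        case: (vL (j + 2))|exact: mD].
    by apply/funext => p; rewrite dot_ccurl_axis.
  - apply/measurable_EFinP; apply: measurable_funB; apply: measurable_funM; try exact: mD;
      exact: measurable_funS (mpoly_meas _).
  (* off the support of [phi] both sides vanish, inside it [v] is polynomial *)
  - apply: aeS vP => p Hp Dp; rewrite dot_ccurl_axis.
    have [Up|nUp] := pselect (U (pt3 p)); first by rewrite Hp// !mxE.
    by rewrite !dphi0 ?mulr0// => /abU.
have E3 : vinner A v (ccurl (fun y => phi y *: @e_ R j)) =
    \int[vol R]_p (meval ((pt3 p) 0) (curl_poly P j) * phi (pt3 p)).
  rewrite E2 (RintegralB measurableT (iPd _ _) (iPd _ _)).
  pose I q := \int[vol R]_p (meval ((pt3 p) 0) q * phi (pt3 p)).
  transitivity (- I (mderiv (j + 2) (P (j + 1))) - - I (mderiv (j + 1) (P (j + 2)))).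
    by congr (_ - _); exact: polynomial_parts.
  rewrite opprK addrC.
  transitivity (\int[vol R]_p (meval ((pt3 p) 0) (mderiv (j + 1) (P (j + 2))) * phi (pt3 p) -
      meval ((pt3 p) 0) (mderiv (j + 2) (P (j + 1))) * phi (pt3 p))).
    by apply/esym/RintegralB => //; exact: iPphi.
  by apply: eq_Rintegral => p _; rewrite /curl_poly mevalB mulrBl.
have := Hw _ (vtest_axis j tA); rewrite E3 E1 => HE.
have iwphi : (vol R).-integrable Q (EFin \o (fun p => w (pt3 p) 0 j * phi (pt3 p))).
  exact: (integrableS mA mQ QD (sL2_prod mA (wL j) (sL2_stest mA tA))).
have icphi : (vol R).-integrable Q
    (EFin \o (fun p => meval ((pt3 p) 0) (curl_poly P j) * phi (pt3 p))).
  by apply: (integrableS measurableT mQ _ (iPphi _)).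
transitivity (\int[vol R]_(p in Q) (w (pt3 p) 0 j * phi (pt3 p)) -
  \int[vol R]_(p in Q) (meval ((pt3 p) 0) (curl_poly P j) * phi (pt3 p))).
  by rewrite -RintegralB//; apply: eq_Rintegral => p _; rewrite mulrBl.
apply/eqP; rewrite subr_eq0; apply/eqP.
transitivity (\int[vol R]_p (w (pt3 p) 0 j * phi (pt3 p))).
  by apply: Rintegral_support => p np; rewrite oboxQ// mulr0.
rewrite -HE; apply/esym; apply: Rintegral_support => p np.
by rewrite oboxQ// mulr0.
Qed.

End Curl.
(** * Conservation of the discrete divergence *)

Section Spaces.
Context {R : realType} (A : set 'rV[R]_3) (Th : seq 'M[R]_(4, 3)) (k : nat).
Hypothesis mA : measurable (@pt3 R @^-1` A : set (R3 R)).
Implicit Types (u v w : vfield R) (f g : sfield R).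

Lemma poly_funD f g : poly_fun k f -> poly_fun k g -> poly_fun k (fun x => f x + g x).
Proof.
move=> [P [P1 P2]] [Q [Q1 Q2]]; exists (P + Q); split; first exact: msizeD_le.
by move=> x; rewrite mevalD P2 Q2.
Qed.

Lemma raviart_thomasD u v :
  raviart_thomas k u -> raviart_thomas k v -> raviart_thomas k (u + v).
Proof.
move=> [p [q [Hp [Q [Q1 Q2]] Hu]]] [p' [q' [Hp' [Q' [Q1' Q2']] Hv]]].
exists (p + p'), (fun x => q x + q' x); split.
- move=> i; rewrite (_ : (fun x => _) = (fun x => p x 0 i + p' x 0 i)).
    exact: poly_funD.
  by apply/funext => x; rewrite mxE.
- exists (Q + Q'); split; first exact: dhomogD.
  by move=> x; rewrite mevalD Q2 Q2'.
- by move=> x; rewrite [LHS]/(u x + v x) Hu Hv scalerDl addrACA.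
Qed.

Lemma is_weak_divD u v f g : vL2 A u -> vL2 A v ->
  is_weak_div A u f -> is_weak_div A v g -> is_weak_div A (u + v) (fun x => f x + g x).
Proof.
move=> uL vL [fL Hf] [gL Hg]; split=> [|phi tphi]; first exact: sL2D.
have wL := vL2_vtest mA (vtest_grad tphi).
rewrite (vinnerDl mA uL vL wL) Hf// Hg// (sinnerDl mA fL gL) ?opprD//.
exact: sL2_stest tphi.
Qed.

Lemma RThD u v : RTh A Th k u -> RTh A Th k v -> RTh A Th k (u + v).
Proof.
move=> [[uL [f Hf]] Pu] [[vL [g Hg]] Pv]; split.
  split; first exact: vL2D.
  by exists (fun x => f x + g x); exact: is_weak_divD.
move=> K KT; have [p Hp up] := Pu K KT; have [q Hq vq] := Pv K KT.
exists (p + q); first exact: raviart_thomasD.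
apply: aeS (aeI up vq) => x [Hx Hx'] Kx.
by rewrite [LHS]/(u _ + v _) Hx// Hx'.
Qed.

Lemma RTh_vL2 : RTh A Th k `<=` vL2 A.
Proof. by move=> v [[]]. Qed.

Lemma vinner_ae u v w : vL2 A u -> vL2 A v -> vL2 A w ->
  ae_on A (fun x => u x = v x) -> vinner A u w = vinner A v w.
Proof.
move=> uL vL wL uv; rewrite /vinner /intg /Rintegral; congr fine.
have md z : vL2 A z -> measurable_fun (@pt3 R @^-1` A)
    (fun p : R3 R => (dot (z (pt3 p)) (w (pt3 p)))%:E).
  move=> zL; apply/measurable_EFinP; apply: measurable_sum => i.
  by apply: measurable_funM; [case: (zL i)|case: (wL i)].
apply: ae_eq_integral => //; [exact: md|exact: md|].
by apply: aeS uv => p H Ap; rewrite H.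
Qed.

(** The sum [u + v] is itself an admissible test field, hence has norm zero. *)
Lemma orthogonal_residual u v w : RTh A Th k u -> RTh A Th k v -> vL2 A w ->
  (forall phi, RTh A Th k phi -> vinner A u phi + vinner A v phi = 0) ->
  vinner A v w = 0 -> vinner A u w = 0.
Proof.
move=> uV vV wL H vw; have uL := RTh_vL2 uV; have vL := RTh_vL2 vV.
have uvV := RThD uV vV; have uvL := RTh_vL2 uvV.
have := cauchy_schwarz mA uvL wL.
rewrite /L2norm (vinnerDl mA uL vL uvL) H// sqrtr0 mul0r normr_le0.
by rewrite (vinnerDl mA uL vL wL) vw addr0 => /eqP.
Qed.

End Spaces.

Section Curl_RTh.
Context {R : realType}.

(** Inside a cell the curl lowers the degree of the Nedelec polynomial, at most
    [k + 1], by one; globally it is orthogonal to gradients. *)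
Lemma curl_N0h (A : set 'rV[R]_3) (Th : seq 'M[R]_(4, 3)) k (v : vfield R) :
  bounded_lipschitz_domain A -> tetrahedral_mesh A Th -> N0h A Th k v ->
  RTh A Th k (curl A v) /\ is_weak_div A (curl A v) (fun=> 0).
Proof.
move=> [_ oA _ _ lA] [_ clA _ _] [[[vL ex] _] Pv].
have mA := measurable_open oA.
have wc : is_weak_curl A v (curl A v) by exact: (getPex ex).
have d0 := is_weak_curl_div0 mA wc.
split => //; split; first by split; [case: wc|exists (fun=> 0)].
move=> K KT; have [p /nedelec_poly[P [HP pP]] vp] := Pv K KT.
exists (poly_field (curl_poly P)).
  by apply: poly_field_raviart_thomas => i; apply: msizeB_le; exact: msize_mderiv.
have KA : interior (tetra K) `<=` A.
  apply: subset_trans (interior_closure_lipschitz oA lA).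
  by apply: interiorS; rewrite clA => x Kx; exists K.
apply: (weak_curl_polynomial mA _ KA vL wc); first exact: open_interior.
apply: aeS vp => x Hx Kx; rewrite Hx//; apply/rowP => i.
by rewrite pP mxE.
Qed.

End Curl_RTh.

Section Conservation.
Context {R : realType} (A : set 'rV[R]_3) (V : set (vfield R)) (T : R).
Hypotheses (mA : measurable (@pt3 R @^-1` A : set (R3 R))) (T0 : 0 < T)
  (VL2 : V `<=` vL2 A).

(** The selected divergence depends on the field only through the set of its weak
    divergences, hence through its pairings with gradients. *)
Lemma weak_div_eq (u v : vfield R) :
  (forall phi, stest A phi -> vinner A u (grad phi) = vinner A v (grad phi)) ->
  div A u = div A v.
Proof.
move=> H; rewrite /div; congr get; apply/seteqP; split => g [gL Hg]; split => // phi tphi.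
  by rewrite -H// Hg.
by rewrite H// Hg.
Qed.

Lemma time_test_derive_continuous (psi : R -> R) : time_test T psi -> continuous (derive1 psi).
Proof.
move=> [dpsi _] t; apply: differentiable_continuous; apply/derivable1_diffP.
exact: (dpsi 1%N).
Qed.

(** Pairing the vector-valued weak derivative with a field orthogonal to it
    leaves a scalar function of vanishing weak derivative. *)
Lemma pairing_constant (f fc df : R -> vfield R) (w : vfield R) :
  continuous_representative A V T f fc -> bochner_L2 A V T f ->
  is_time_deriv A V T f df -> vL2 A w ->
  {ae leb R, forall t : R, t \in `]0, T[ -> vinner A (df t) w = 0} ->
  forall t, t \in `[0, T] -> vinner A (fc t) w = vinner A (fc 0) w.
Proof.
move=> [fcV fcc ffc] [fV _ _] [[dfV _ _] Hdf] wL dfw.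
pose u t := vinner A (fc t) w.
have cu : {within `[0, T], continuous u}.
  apply/subspace_continuousP => t tT; apply/cvgrPdist_lt => e e0.
  have W0 : 0 < L2norm A w + 1 by rewrite ltr_pwDr// sqrtr_ge0.
  have near_t : \forall s \near within `[0, T] (nbhs t),
      `|L2norm A (fc s - fc t)| < e / (L2norm A w + 1).
    by have := fcc t tT; move/cvgr0Pnorm_lt; apply; rewrite divr_gt0.
  have near_T : \forall s \near within `[0, T] (nbhs t), s \in `[0, T].
    exact: withinT.
  apply: filterS2 near_t near_T => s st sT.
  have Ls := VL2 (fcV s sT); have Lt := VL2 (fcV t tT).
  rewrite /u distrC -(vinnerBl mA Ls Lt wL).
  apply: le_lt_trans (cauchy_schwarz mA _ wL) _.
    by apply: (vL2D mA) => //; exact: vL2N.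
  apply: (@le_lt_trans _ _ (L2norm A (fc s - fc t) * (L2norm A w + 1))).
    by rewrite ler_wpM2l ?sqrtr_ge0// lerDl.
  by rewrite -ltr_pdivlMr//; apply: le_lt_trans st; exact: ler_norm.
have Hu psi : time_test T psi -> \int[leb R]_(t in `]0, T[) (derive1 psi t * u t) = 0.
  move=> tpsi; have [I B1 B2] := Hdf psi tpsi.
  have iu : (leb R).-integrable `]0, T[ (fun t => (derive1 psi t * u t)%:E).
    have cpsi := time_test_derive_continuous tpsi.
    have I1 : (leb R).-integrable [set` `[0, T]] (EFin \o (fun t => derive1 psi t * u t)).
      apply: continuous_compact_integrable; first exact: segment_compact.
      by move=> x; apply: cvgM; [exact: continuous_subspaceT|exact: cu].
    by apply: integrableS I1 => //; exact: subset_itv_oo_cc.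
  rewrite -(bochner_pairing mA VL2 wL B1 _ iu).
    rewrite (bochner_pairing mA VL2 wL B2 (g := fun=> 0)).
    + by rewrite Rintegral_cst ?mul0r//; exact: measurable_itv.
    + apply: aeS (aeI dfV dfw) => t [H1 H2] tT; have dL := VL2 (H1 tT).
      split; first by apply: (vL2N mA); exact: vL2Z.
      by rewrite -scaleN1r scalerA (vinnerZl mA)// H2// mulr0.
    + exact: integrable0.
  apply: aeS (aeI fV ffc) => t [H1 H2] tT; have fL := VL2 (H1 tT).
  split; first exact: vL2Z.
  rewrite (vinnerZl mA)//; congr (_ * _); apply/esym/vinner_ae => //; last exact: H2.
  by apply/VL2/fcV; move: tT; rewrite !in_itv/= => /andP[/ltW-> /ltW->].
move=> t tT.
have zT : (0 : R) \in `[0, T] by rewrite in_itv/= lexx ltW.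
by apply/eqP; rewrite eq_le !(weak_derive0_le T0 cu Hu).
Qed.

Lemma ae_ne0 : {ae leb R, forall t : R, t != 0}.
Proof.
exists [set 0]; split => [||t /= /negP].
- exact: measurable_set1.
- exact: lebesgue_measure_set1.
by rewrite negbK => /eqP.
Qed.

End Conservation.
Theorem lemma3 (R : realType) (Omega : set 'rV[R]_3) (T : R)
    (H : Type) (mesh : H -> seq 'M[R]_(4, 3)) (h : H) (k : nat)
    (Eh Bh Bhc : R -> vfield R) :
  bounded_lipschitz_domain Omega ->
  0 < T ->
  (forall h', tetrahedral_mesh Omega (mesh h')) ->
  shape_regular mesh ->
  bochner_H1 Omega (N0h Omega (mesh h) k) T Eh ->
  bochner_H1 Omega (RTh Omega (mesh h) k) T Bh ->
  continuous_representative Omega (RTh Omega (mesh h) k) T Bh Bhc ->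
  {ae leb R, forall t : R, t \in `]0, T[ ->
     forall phi, RTh Omega (mesh h) k phi ->
       vinner Omega (time_deriv Omega (RTh Omega (mesh h) k) T Bh t) phi
       + vinner Omega (curl Omega (Eh t)) phi = 0} ->
  (forall q, Qh Omega (mesh h) k q ->
     {ae leb R, forall t : R, t \in `[0, T[ ->
        sinner Omega (div Omega (Bh t)) q
        = sinner Omega (div Omega (Bhc 0)) q}) /\
  ((forall q, Qh Omega (mesh h) k q ->
      sinner Omega (div Omega (Bhc 0)) q = 0) ->
   {ae leb R, forall t : R, t \in `[0, T[ ->
      forall q, Qh Omega (mesh h) k q ->
        sinner Omega (div Omega (Bh t)) q = 0}).
Proof.
move=> bO T0 mshs _ [[EV _ _] _] [LB exB] rB faraday.
have msh := mshs h; have mO : measurable (@pt3 R @^-1` Omega : set (R3 R)).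
  by case: bO => _ oO _ _ _; exact: measurable_open.
set V := RTh Omega (mesh h) k in LB exB rB faraday *.
have VL2 : V `<=` vL2 Omega := @RTh_vL2 R Omega (mesh h) k.
have dB : is_time_deriv Omega V T Bh (time_deriv Omega V T Bh) := getPex exB.
have dBV : {ae leb R, forall t : R, t \in `]0, T[ -> V (time_deriv Omega V T Bh t)}.
  by case: dB => -[].
have orth phi : stest Omega phi -> {ae leb R, forall t : R, t \in `]0, T[ ->
    vinner Omega (time_deriv Omega V T Bh t) (grad phi) = 0}.
  move=> tphi; apply: aeS (aeI EV (aeI dBV faraday)) => t [HE [HB HF]] tT.
  have [cV [_ c0]] := curl_N0h bO msh (HE tT).
  apply: (orthogonal_residual mO (HB tT) cV _ (HF tT)).
    exact: vL2_vtest (vtest_grad tphi).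
  by rewrite c0// (sinner0l mO) oppr0.
have div_const : {ae leb R, forall t : R, t \in `[0, T[ -> div Omega (Bh t) = div Omega (Bhc 0)}.
  have [BcV _ BBc] := rB; have [BV _ _] := LB.
  apply: aeS (aeI ae_ne0 (aeI BV BBc)) => t [t0 [HV HBc]] tT.
  have tT' : t \in `]0, T[.
    by move: tT; rewrite !in_itv/= => /andP[t0' ->]; rewrite lt0r t0 t0'.
  have tTc : t \in `[0, T] by move: tT; rewrite !in_itv/= => /andP[-> /ltW].
  apply: weak_div_eq => phi tphi; have wL := vL2_vtest mO (vtest_grad tphi).
  rewrite -(pairing_constant mO T0 VL2 rB LB dB wL (orth _ tphi) tTc).
  by apply: (vinner_ae mO) => //; [exact/VL2/HV|exact/VL2/BcV|exact: HBc].
split=> [q _|H0].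
  by apply: aeS div_const => t Ht tT; rewrite Ht.
by apply: aeS div_const => t Ht tT q Qq; rewrite Ht//; exact: H0.
Qed.
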